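(* For every fixed integer $r\ge 2$, Locally Rainbow Path is NP-hard.
   Context: Digraphs have no self-loops. A path of length $q$ is a sequence $(v_0,\dots,v_q)$ of pairwise distinct vertices with $(v_{i-1},v_i)$ an arc for all $i\in\{1,\dots,q\}$. For a vertex coloring $c$, a path $(v_0,\dots,v_q)$ is $r$-rainbow if for every $i\in\{0,\dots,q-r\}$ the vertices $v_i,\dots,v_{i+r}$ have pairwise different colors. Locally Rainbow Path: given a digraph $G$, a vertex coloring $c\colon V(G)\to C$, distinct vertices $s,t$, and integers $r,\ell\ge 0$, decide whether there is an $r$-rainbow $s$-$t$ path of length at most $\ell$ in $G$. *)

(* Defs.v *)
From mathcomp Require Import all_boot all_order all_algebra.

Set Implicit Arguments.
Unset Strict Implicit.
Unset Printing Implicit Defensive.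

Local Open Scope nat_scope.

(* Nondeterministic machines with [work.+1] two-way infinite tapes.  The input
   is on tape [ord0], the output on tape [ord_max].  An action gives the next
   state and, for each tape, the symbol written and the head move: [None] stays,
   [Some true] goes right, [Some false] goes left.  The machine halts exactly
   when no action is available. *)
Record machine := Machine {
  state : finType;
  symbol : finType;
  work : nat;
  blank : symbol;
  start : state;
  accepting : pred state;
  delta : state -> {ffun 'I_work.+1 -> symbol} ->
          {set state * {ffun 'I_work.+1 -> symbol * option bool}}
}.

Definition deterministic (M : machine) : Prop :=
  forall (q : state M) (a : {ffun 'I_(work M).+1 -> symbol M}),
    #|delta q a| <= 1.

Record config (M : machine) := Config {
  cstate : state M;
  chead : 'I_(work M).+1 -> int;
  ctape : 'I_(work M).+1 -> int -> symbol M
}.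

Definition scanned (M : machine) (c : config M) :
    {ffun 'I_(work M).+1 -> symbol M} :=
  [ffun k => ctape c k (chead c k)].

Definition move_head (d : option bool) (z : int) : int :=
  match d with
  | None => z
  | Some true => (z + 1)%R
  | Some false => (z - 1)%R
  end.

Definition apply_action (M : machine) (c : config M)
    (a : state M * {ffun 'I_(work M).+1 -> symbol M * option bool}) :
    config M :=
  Config a.1
    (fun k => move_head (a.2 k).2 (chead c k))
    (fun k z => if z == chead c k then (a.2 k).1 else ctape c k z).

Inductive reaches (M : machine) : nat -> config M -> config M -> Prop :=
| reaches0 c : reaches 0 c c
| reachesS n c a c' :
    a \in delta (cstate c) (scanned c) ->
    reaches n (apply_action c a) c' -> reaches n.+1 c c'.

Definition halted (M : machine) (c : config M) : Prop :=
  delta (cstate c) (scanned c) = set0.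

(* How an external alphabet is represented by tape symbols. *)
Definition letters (M : machine) (A : finType) (i : A -> symbol M) : Prop :=
  injective i /\ forall a, i a != blank M.

Definition init_config (M : machine) (A : finType) (i : A -> symbol M)
    (x : seq A) : config M :=
  Config (start M) (fun _ => 0%R)
    (fun k z => if (k == ord0) then
                  if z is Posz j then nth (blank M) (map i x) j else blank M
                else blank M).

(* The output is the word written from cell 0 up to the first blank. *)
Definition has_output (M : machine) (A : finType) (o : A -> symbol M)
    (c : config M) (y : seq A) : Prop :=
  forall j : nat, j <= size y ->
    ctape c ord_max (Posz j) = nth (blank M) (map o y) j.

Definition poly_bounded (T : nat -> nat) : Prop :=
  exists c d : nat, forall n, T n <= c * n ^ d + c.

Definition language (A : finType) := seq A -> Prop.

Definition NP (A : finType) (L : language A) : Prop :=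
  exists (M : machine) (i : A -> symbol M) (T : nat -> nat),
    [/\ letters i,
        poly_bounded T,
        (forall x n c, reaches n (init_config i x) c -> n <= T (size x)) &
        (forall x, L x <->
           exists n c, [/\ reaches n (init_config i x) c, halted c &
                           accepting (cstate c)])].

Definition polytime (A B : finType) (f : seq A -> seq B) : Prop :=
  exists (M : machine) (i : A -> symbol M) (o : B -> symbol M)
         (T : nat -> nat),
    [/\ deterministic M, letters i, letters o, poly_bounded T &
        forall x, exists n c,
          [/\ n <= T (size x), reaches n (init_config i x) c, halted c &
              has_output o c (f x)]].

Definition poly_reducible (A B : finType) (L : language A) (L' : language B) :
    Prop :=
  exists f : seq A -> seq B, polytime f /\ forall x, L x <-> L' (f x).

Definition NP_hard (B : finType) (L : language B) : Prop :=
  forall (A : finType) (L' : language A), NP L' -> poly_reducible L' L.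

(* Paths are nonempty vertex sequences; a path with at most [r] vertices has no
   window of [r.+1] vertices and is vacuously [r]-rainbow. *)
Definition rainbow (V C : eqType) (r : nat) (c : V -> C) (p : seq V) : Prop :=
  forall i, i + r < size p -> uniq (map c (take r.+1 (drop i p))).

Definition has_rainbow_path (V : finType) (C : eqType) (arc : rel V)
    (c : V -> C) (s t : V) (r l : nat) : Prop :=
  exists p : seq V,
    [/\ path arc s p, uniq (s :: p), last s p = t,
        rainbow r c (s :: p) & size p <= l].

Record instance := Instance {
  nverts : nat;
  arcs : {set 'I_nverts * 'I_nverts};
  loopless : [forall v, (v, v) \notin arcs];
  color : {ffun 'I_nverts -> nat};
  source : 'I_nverts;
  target : 'I_nverts;
  source_neq_target : source != target;
  max_length : nat
}.

Definition yes_instance (r : nat) (I : instance) : Prop :=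
  has_rainbow_path (fun u v => (u, v) \in arcs I) (color I)
    (source I) (target I) r (max_length I).

(* Binary notation, least significant bit first, without leading zeros;
   the first argument is fuel. *)
Fixpoint bits_rec (k n : nat) : seq bool :=
  if k is k'.+1 then
    if n == 0 then [::] else odd n :: bits_rec k' n./2
  else [::].

Definition bits (n : nat) : seq bool := bits_rec n n.

(* Words over {0, 1, #}, with [None] for #: every field is followed by #. *)
Definition encode_fields (s : seq (seq bool)) : seq (option bool) :=
  flatten [seq rcons (map Some f) None | f <- s].

(* The numbers s, t, l and the colors in binary, then the rows of the adjacency
   matrix. *)
Definition encode (I : instance) : seq (option bool) :=
  encode_fields
    ([:: bits (source I); bits (target I); bits (max_length I)]
     ++ [seq bits (color I v) | v <- enum 'I_(nverts I)]
     ++ [seq [seq (u, v) \in arcs I | v <- enum 'I_(nverts I)]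
            | u <- enum 'I_(nverts I)]).

Definition locally_rainbow_path (r : nat) : language (option bool) :=
  fun w => exists I : instance, w = encode I /\ yes_instance r I.

Lemma bits_inj : injective bits.
Proof.
pose val := foldr (fun (b : bool) m => b + m.*2) 0.
suff H k n : n <= k -> val (bits_rec k n) = n.
  by move=> m n e; rewrite -(H m m (leqnn _)) -(H n n (leqnn _)) -/(bits m) e.
elim: k n => [|k IH] n /=; first by rewrite leqn0 => /eqP ->.
case: eqP => [-> //|/eqP n0] le_nk /=.
rewrite IH ?odd_double_half // -ltnS (leq_trans _ le_nk) //.
by rewrite ltn_half_double -addnn -[X in X < _]addn0 ltn_add2l lt0n.
Qed.

Lemma encode_fields_inj : injective encode_fields.
Proof.
have nonnil f s : encode_fields (f :: s) <> [::].
  by rewrite /encode_fields /=; case: f.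
elim=> [|f s IH] [|g t] //; first by move/esym/nonnil.
  by move/nonnil.
rewrite /encode_fields /= -!/(encode_fields _) !cat_rcons => e.
suff [-> /IH -> //] : f = g /\ encode_fields s = encode_fields t.
elim: f g e => [|a f IHf] [|b g] //=; first by case.
by case=> -> /IHf [-> ->].
Qed.

Lemma encode_inj : injective encode.
Proof.
move=> [n a la c s t st l] [n' a' la' c' s' t' st' l'] /encode_fields_inj /=.
case=> /bits_inj es /bits_inj et /bits_inj el e.
have en : n = n'.
  move: (congr1 size e); rewrite !size_cat !size_map -!enumT !size_enum_ord.
  by rewrite !addnn; apply: double_inj.
subst n' l'; move: e => /eqP.
rewrite eqseq_cat ?size_map // => /andP[/eqP ec /eqP ea].
have {}ec : c = c'.
  apply/ffunP => v; apply: bits_inj.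
  exact: ((eq_in_map _ _ _).2 ec v (mem_enum _ _)).
have {}ea : a = a'.
  apply/setP=> -[u v].
  have eu := (eq_in_map _ _ _).2 ea u (mem_enum _ _).
  exact: ((eq_in_map _ _ _).2 eu v (mem_enum _ _)).
move/val_inj: es => es; move/val_inj: et => et.
subst a' c' s' t'.
by rewrite (bool_irrelevance la la') (bool_irrelevance st st').
Qed.

(* Main.v *)
(* A counter machine whose registers stay polynomially bounded is a Turing machine
   that keeps each register as the position of a head on a tape with a marked bottom
   cell, so every function written with bounded sums over a few arithmetic primitives
   is computable in polynomial time.  That is enough for the following reduction.

   A run of a nondeterministic machine is a sequence of items, one per step: the time,
   the state, the scanned symbols, the action taken, the head positions, and for each
   tape the last visit to the current cell.  Consecutive items must match, and whether
   every scanned symbol is the one last written in its cell is a condition on pairs of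
   items.  So acceptance is the existence of a path in a graph on polynomially many
   items that avoids a set of conflicting pairs.

   A conflict is expressed by a shared vertex.  Item o is replaced by a chain of
   segments, one for each item o'; if o and o' conflict, the segments (o, o') and
   (o', o) meet in their middle vertex, so a simple path cannot take both chains.  On
   either side of that vertex the colours are a, b along one segment and b, a along the
   other, so a 2-rainbow path cannot switch segments there; r+1 further vertices
   complete each segment, which makes its chain r-rainbow. *)

Require Import Defs.
From mathcomp Require Import all_boot all_algebra zify.
From Stdlib Require Import FunctionalExtensionality.

Set Implicit Arguments.
Unset Strict Implicit.
Unset Printing Implicit Defensive.

(** * Structured programs for Turing machines *)

Section Programs.
Variables A B : finType.

Record store := Store { inp : int; regs : nat -> nat; outp : seq B }.

Definition insym (x : seq A) (z : int) : option A :=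
  if z is Posz j then onth x j else None.

(** A step sees only the scanned input symbol and which registers are nonzero; a head on a tape with
    a marked bottom cell can observe exactly the latter. *)
Definition view : Type := option A * (nat -> bool).

Definition look (x : seq A) (s : store) : view :=
  (insym x (inp s), fun k => regs s k != 0).

Record act := Act { ain : option bool; areg : nat -> option bool; aout : option B }.

Definition nop := Act None (fun=> None) None.

Definition perform (a : act) (s : store) : store :=
  Store (move_head (ain a) (inp s))
    (fun k => match areg a k with
              | None => regs s k
              | Some true => (regs s k).+1
              | Some false => (regs s k).-1
              end)
    (if aout a is Some b then rcons (outp s) b else outp s).

Record prog := Prog {
  pst : finType;
  pent : pst;
  pnext : pst -> view -> act * option pst
}.

Inductive runs (x : seq A) (p : prog) : nat -> pst p -> store -> store -> Prop :=
| runs_last q s a : pnext q (look x s) = (a, None) -> runs x 1 q s (perform a s)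
| runs_step n q s a q' s' : pnext q (look x s) = (a, Some q') ->
    runs x n q' (perform a s) s' -> runs x n.+1 q s s'.

Definition takes (x : seq A) (p : prog) (n : nat) (s s' : store) : Prop :=
  exists2 m, m <= n & runs x m (pent p) s s'.

Definition doP (f : view -> act) : prog := @Prog unit tt (fun _ v => (f v, None)).

Definition seqP (p1 p2 : prog) : prog :=
  @Prog (pst p1 + pst p2)%type (inl (pent p1))
    (fun q v => match q with
     | inl q1 => let: (a, o) := pnext q1 v in
                 (a, Some (if o is Some q1' then inl q1' else inr (pent p2)))
     | inr q2 => let: (a, o) := pnext q2 v in (a, omap inr o)
     end).

Definition whileP (t : view -> bool) (p : prog) : prog :=
  @Prog (option (pst p)) None
    (fun q v => match q with
     | None => (nop, if t v then Some (Some (pent p)) else None)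
     | Some q1 => let: (a, o) := pnext q1 v in (a, Some o)
     end).

Lemma perform_nop s : perform nop s = s.
Proof. by case: s. Qed.

Lemma takes_le x p n n' s s' : n <= n' -> takes x p n s s' -> takes x p n' s s'.
Proof. by move=> le [m /leq_trans/(_ le) ? ?]; exists m. Qed.

Lemma takes_do x f s : takes x (doP f) 1 s (perform (f (look x s)) s).
Proof. by exists 1 => //; apply: runs_last. Qed.

Lemma takes_seq x p1 p2 n1 n2 s1 s2 s3 :
  takes x p1 n1 s1 s2 -> takes x p2 n2 s2 s3 ->
  takes x (seqP p1 p2) (n1 + n2) s1 s3.
Proof.
move=> [m1 le1 r1] [m2 le2 r2]; exists (m1 + m2); first exact: leq_add.
have {}r2 : runs x m2 (inr (pent p2) : pst (seqP p1 p2)) s2 s3.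
  elim: r2 => {le2} [q s a e|n q s a q' s' e _ IH].
    by apply: runs_last; rewrite /= e.
  by apply: runs_step IH; rewrite /= e.
rewrite /=; elim: {le1} r1 r2 => [q s a e|n q s a q' s' e _ IH] r2.
  by apply: (@runs_step _ _ _ _ _ a) r2; rewrite /= e.
by apply: runs_step (IH r2); rewrite /= e.
Qed.

Lemma takes_while0 x (t : view -> bool) p s : ~~ t (look x s) -> takes x (whileP t p) 1 s s.
Proof.
move=> nt; exists 1 => //; rewrite -{2}(perform_nop s); apply: runs_last.
by rewrite /= (negPf nt).
Qed.

Lemma takes_whileS x (t : view -> bool) p n1 n2 s1 s2 s3 : t (look x s1) ->
  takes x p n1 s1 s2 -> takes x (whileP t p) n2 s2 s3 ->
  takes x (whileP t p) (n1 + n2).+1 s1 s3.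
Proof.
move=> t1 [m1 le1 r1] [m2 le2 r2]; exists (m1 + m2).+1; first by rewrite ltnS leq_add.
apply: (@runs_step x (whileP t p) _ _ _ nop (Some (pent p))); first by rewrite /= t1.
rewrite perform_nop; elim: {le1 t1} r1 r2 => [q s a e|n q s a q' s' e _ IH] r2.
  by apply: (@runs_step _ _ _ _ _ a) r2; rewrite /= e.
by apply: runs_step (IH r2); rewrite /= e.
Qed.

(** The family [S] is the loop invariant: [S j] is the store before round [j]. Each round costs one
    extra step for the test. *)
Lemma takes_loop x (t : view -> bool) p (S : nat -> store) k n :
  (forall j, j < k -> t (look x (S j)) /\ takes x p n (S j) (S j.+1)) ->
  ~~ t (look x (S k)) ->
  takes x (whileP t p) (k * n.+1).+1 (S 0) (S k).
Proof.
elim: k S => [|k IH] S H nt; first by rewrite mul0n; apply: takes_while0.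
have [t0 p0] := H 0 isT.
rewrite mulSn; apply: takes_le (takes_whileS t0 p0 (IH (fun j => S j.+1) _ nt)).
  by lia.
by move=> j lt; apply: H.
Qed.

(** Registers are indexed by all of [nat], but a machine has a fixed number of tapes; under this
    condition [R] counter tapes suffice. *)
Definition bounded_regs (R : nat) (p : prog) : Prop :=
  (forall q v w f, (forall k, k < R -> f k = w k) -> pnext (p := p) q (v, f) = pnext q (v, w))
  /\ forall q v k, R <= k -> areg (pnext (p := p) q v).1 k = None.

Definition local p := exists R, bounded_regs R p.

Lemma bounded_regs_le R R' p : R <= R' -> bounded_regs R p -> bounded_regs R' p.
Proof.
move=> le [H1 H2]; split=> [q v w f e|q v k lek].
  by apply: H1 => k ltk; apply: e; apply: leq_trans ltk le.
by apply: H2; apply: leq_trans le lek.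
Qed.

Lemma local_do R (f : view -> act) :
  (forall v w g, (forall k, k < R -> g k = w k) -> f (v, g) = f (v, w)) ->
  (forall v k, R <= k -> areg (f v) k = None) -> local (doP f).
Proof.
move=> H1 H2; exists R; split=> [q v w g e|q v k le] /=; last exact: H2.
by rewrite (H1 _ _ _ e).
Qed.

Lemma local_seq p1 p2 : local p1 -> local p2 -> local (seqP p1 p2).
Proof.
move=> [R1 b1] [R2 b2]; exists (maxn R1 R2).
have {b1}[b1 c1] := bounded_regs_le (leq_maxl R1 R2) b1.
have {b2}[b2 c2] := bounded_regs_le (leq_maxr R1 R2) b2.
split=> [[q|q] v w f e|[q|q] v k le] /=.
- by rewrite (b1 _ _ _ _ e).
- by rewrite (b2 _ _ _ _ e).
- by have := c1 q v k le; case: pnext.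
- by have := c2 q v k le; case: pnext.
Qed.

Lemma local_while R (t : view -> bool) p :
  (forall v w g, (forall k, k < R -> g k = w k) -> t (v, g) = t (v, w)) ->
  local p -> local (whileP t p).
Proof.
move=> ht [R1 b1]; exists (maxn R R1).
have {b1}[b1 c1] := bounded_regs_le (leq_maxr R R1) b1.
split=> [[q|] v w f e|[q|] v k le] //=.
- by rewrite (b1 _ _ _ _ e).
- rewrite (ht _ w) // => k ltk; apply: e; exact: leq_trans (leq_maxl _ _).
- by have := c1 q v k le; case: pnext.
Qed.

(** * Simulation of a program by a machine with one tape per register *)

Section TM.
Variables (R : nat) (p : prog).
Hypothesis pR : bounded_regs R p.

Definition tm_symbol : finType := option (A + option B)%type.

(* The bottom mark at cell 0 of the tapes that serve as counters. *)
Definition mark : tm_symbol := Some (inr None).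

(* [None] is the start state, in which the bottom marks are written. *)
Definition tm_state : finType := option (option (pst p)).

Definition is_counter (k : 'I_R.+2) := (k != ord0) && (k != ord_max).

Definition tm_view (a : {ffun 'I_R.+2 -> tm_symbol}) : view :=
  (if a ord0 is Some (inl u) then Some u else None,
   fun k => (k < R) && (a (inord k.+1) != mark)).

(** Tape [k.+1] carries register [k]. A decrement at the bottom mark leaves the head in place, in
    agreement with [0.-1 = 0]. *)
Definition tm_action (a : {ffun 'I_R.+2 -> tm_symbol}) (ac : act) :
    {ffun 'I_R.+2 -> tm_symbol * option bool} :=
  [ffun k => if k == ord0 then (a k, ain ac)
    else if k == ord_max then
      (if aout ac is Some b then (Some (inr (Some b)), Some true) else (a k, None))
    else (a k, if (areg ac k.-1 == Some false) && (a k == mark) then None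
               else areg ac k.-1)].

Definition tm_delta (q : tm_state) (a : {ffun 'I_R.+2 -> tm_symbol}) :
    {set tm_state * {ffun 'I_R.+2 -> tm_symbol * option bool}} :=
  match q with
  | None => [set (Some (Some (pent p)), [ffun k => (if is_counter k then mark else a k, None)])]
  | Some None => set0
  | Some (Some q) =>
      let: (ac, q') := pnext q (tm_view a) in [set (Some q', tm_action a ac)]
  end.

Definition tm : machine :=
  @Machine tm_state tm_symbol R.+1 None None (fun=> true) tm_delta.

(** A register lives in the head position alone, so the contents of the counter tapes are the same
    in all these configurations. *)
Definition tm_config (x : seq A) (q : tm_state) (s : store) : config tm :=
  @Config tm q
    (fun k => if k == ord0 then inp s
              else if k == ord_max then Posz (size (outp s)) else Posz (regs s k.-1))
    (fun k z => if k == ord0 then omap inl (insym x z)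
       else if k == ord_max then
         (if z is Posz j then omap (inr \o Some) (onth (outp s) j) else None)
       else if z == 0%R then mark else None).

Lemma tm_deterministic : deterministic tm.
Proof.
move=> [[q|]|] a /=; rewrite ?cards0 ?cards1 //.
by case: pnext => ac q'; rewrite cards1.
Qed.

Lemma tm_look x q s : (forall k, R <= k -> regs s k = 0) ->
  pnext (p := p) q (tm_view (scanned (tm_config x (Some (Some q)) s))) = pnext q (look x s).
Proof.
move=> s0; rewrite /look.
have -> : insym x (inp s) = (tm_view (scanned (tm_config x (Some (Some q)) s))).1.
  by rewrite /= ffunE /=; case: insym.
apply: pR.1 => k ltk; rewrite /= ltk /= ffunE /=.
have lt2 : k.+1 < R.+2 by lia.
rewrite -!val_eqE /= !inordK //= eqSS ltn_eqF //=.
by case: (regs s k).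
Qed.

Lemma tm_step x q q' s a : (forall k, R <= k -> regs s k = 0) ->
  pnext (p := p) q (look x s) = (a, q') ->
  reaches 1 (tm_config x (Some (Some q)) s) (tm_config x (Some q') (perform a s)).
Proof.
move=> s0 e.
pose c := tm_config x (Some (Some q)) s.
apply: (@reachesS tm 0 c (Some q', tm_action (scanned c) a)).
  by rewrite /= tm_look // e; apply/set1P.
suff -> : apply_action c (Some q', tm_action (scanned c) a) =
          tm_config x (Some q') (perform a s) by apply: reaches0.
rewrite /apply_action /tm_config /=; congr (@Config tm).
  apply: functional_extensionality => k; rewrite !ffunE.
  case: ifP => k0 //=; case: ifP => k1 //=.
    case: (aout a) => [b|] //=; rewrite size_rcons; lia.
  case: (areg a k.-1) => [[]|] //=; first lia.
  rewrite k0 k1 /=; case: (regs s k.-1) => [|n] //=; lia.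
apply: functional_extensionality => k; apply: functional_extensionality => z.
(* Writing back the scanned symbol is the identity; only a step that prints changes a tape. *)
have idw (u : tm_symbol) h w : (h = z -> u = w) -> (if z == h then u else w) = w.
  by move=> e'; case: eqP => // zh; apply: e'.
rewrite !ffunE /=; case: (k == ord0) => /=; first by apply: idw => ->.
case: (k == ord_max) => /=; last by apply: idw => ->.
case: (aout a) => [b|] /=; last by apply: idw => <-.
rewrite -cats1; case: z {idw} => [j|j] //=.
rewrite onth_cat eqz_nat; case: ltngtP => // [gt|->]; last by rewrite subnn.
by rewrite !onth_default //=; lia.
Qed.

Lemma reaches_trans (M : machine) n1 n2 (c1 c2 c3 : config M) :
  reaches n1 c1 c2 -> reaches n2 c2 c3 -> reaches (n1 + n2) c1 c3.
Proof.
by move=> r1 r2; elim: r1 r2 => [//|n c a c' ma _ IH] /IH; apply: reachesS.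
Qed.

Lemma tm_runs x n q s s' : (forall k, R <= k -> regs s k = 0) -> runs x n q s s' ->
  reaches n (tm_config x (Some (Some q)) s) (tm_config x (Some None) s').
Proof.
move=> s0 r; elim: r s0 => {n q s s'} [q s a e|n q s a q' s' e _ IH] s0.
  exact: tm_step.
rewrite -add1n; apply: (reaches_trans (tm_step s0 e)); apply: IH => k le /=.
by have := pR.2 q (look x s) k le; rewrite e /= => ->; exact: s0.
Qed.

Definition empty_store := Store 0%R (fun=> 0) [::].

Lemma tm_init x :
  reaches 1 (init_config (M := tm) (Some \o inl) x)
    (tm_config x (Some (Some (pent p))) empty_store).
Proof.
set c := init_config _ _.
pose t : {ffun 'I_R.+2 -> tm_symbol * option bool} :=
  [ffun k => (if is_counter k then mark else scanned c k, None)].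
apply: (@reachesS tm 0 c (Some (Some (pent p)), t)); first by rewrite /= inE.
suff -> : apply_action c (Some (Some (pent p)), t) =
          tm_config x (Some (Some (pent p))) empty_store by apply: reaches0.
rewrite /apply_action /tm_config; congr (@Config tm).
  by apply: functional_extensionality => k; rewrite !ffunE /=; do 2?case: ifP.
apply: functional_extensionality => k; apply: functional_extensionality => z.
rewrite !ffunE /is_counter /=.
have nthE j : nth None [seq (Some \o inl) i | i <- x] j = omap inl (onth x j) :> tm_symbol.
  by elim: x {c t} j => [|u x IH] [|j] //=.
case: (k == ord0) => /=; first by case: (z =P _) => [->|_]; [|case: z => /=].
case: (k == ord_max) => /=; last by case: ifP.
by case: ifP => _; case: z => // j; rewrite onth0n.
Qed.

End TM.

End Programs.

Lemma prog_polytime (A B : finType) (f : seq A -> seq B) (p : prog A B) (T : nat -> nat) :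
  local p -> poly_bounded T ->
  (forall x, exists2 s, outp s = f x & takes x p (T (size x)) (empty_store B) s) ->
  polytime f.
Proof.
move=> [R pR] [c [d Tb]] H.
(* The additional step writes the bottom marks. *)
exists (tm R p), (Some \o inl), (fun b => Some (inr (Some b))), (fun n => (T n).+1).
split.
- exact: tm_deterministic.
- by split=> // a b [].
- by split=> // a b [].
- by exists c.+1, d => n; have := Tb n; lia.
move=> x; have [s <- [n le r]] := H x.
exists n.+1, (@tm_config _ _ R p x (Some None) s); split => //.
  by rewrite -add1n; apply: reaches_trans (@tm_init _ _ R p x) (tm_runs pR _ r).
move=> j _ /=.
rewrite eqxx; elim: (outp s) j => [|b y IH] [|j] /=; by rewrite ?IH.
Qed.

(** * Arithmetic expressions and output programs *)

(** Monotonicity gives closure under composition. The base [n + 2] is at least 2, so a larger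
    exponent absorbs constants and sums. *)
Definition polyn (p : nat -> nat) : Prop :=
  {homo p : m n / m <= n} /\ exists d, forall n, p n <= (n + 2) ^ d.

Lemma polyn_const c : polyn (fun=> c).
Proof.
split=> //; exists c => n; apply: leq_trans (ltnW (ltn_expl c (ltnSn 1))) _.
by case: c => // c; rewrite leq_exp2r ?leq_addl.
Qed.

Lemma polyn_id : polyn id.
Proof. by split=> //; exists 1 => n; rewrite expn1 leq_addr. Qed.

Lemma polyn_mul p q : polyn p -> polyn q -> polyn (fun n => p n * q n).
Proof.
move=> [hp [d dp]] [hq [e dq]]; split.
  by move=> m n le; apply: leq_mul; [apply: hp | apply: hq].
by exists (d + e) => n; rewrite expnD; apply: leq_mul.
Qed.

Lemma polyn_add p q : polyn p -> polyn q -> polyn (fun n => p n + q n).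
Proof.
move=> [hp [d dp]] [hq [e dq]]; split.
  by move=> m n le; apply: leq_add; [apply: hp | apply: hq].
(* For [a, b >= 1] one has [a + b <= 2ab], and the factor 2 costs one more power. *)
exists (d + e).+1 => n; apply: leq_trans (leq_add (dp n) (dq n)) _.
rewrite expnS expnD.
have : 0 < (n + 2) ^ d by rewrite expn_gt0 addn2.
have : 0 < (n + 2) ^ e by rewrite expn_gt0 addn2.
move: (_ ^ d) (_ ^ e) => a b; nia.
Qed.

Lemma polyn_comp p q : polyn p -> polyn q -> polyn (p \o q).
Proof.
move=> [hp [d dp]] [hq [e dq]]; split=> [m n le|]; first by apply/hp/hq.
(* With [a = (n + 2)^e >= 1], [a + 2 <= 4a <= (n + 2)^2 a]. *)
exists (e.+2 * d) => n /=; apply: leq_trans (dp _) _.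
rewrite expnM; case: d {dp} => // d; rewrite leq_exp2r // !expnS.
have := dq n; have : 0 < (n + 2) ^ e by rewrite expn_gt0 addn2.
move: (_ ^ e) => a; nia.
Qed.

Lemma polyn_bounded p : polyn p -> poly_bounded p.
Proof.
move=> [_ [d dp]]; exists (4 ^ d), d => n; apply: leq_trans (dp n) _.
case: n => [|n].
  apply: leq_trans (leq_addl _ _); rewrite add0n.
  by case: d {dp} => // d; rewrite leq_exp2r.
rewrite -expnMn; apply: leq_trans (leq_addr _ _).
by case: d {dp} => // d; rewrite leq_exp2r //; lia.
Qed.

Section Expr.
Variable A : finType.

(* Variables are de Bruijn indices into an environment of numbers;
   [ESum e1 e2] binds the summation index in [e2], and [ELift e] discards the
   innermost variable. *)
Inductive expr :=
| EVar of nat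
| ELift of expr
| EOne
| ELen
| EInp of (option A -> bool) & expr
| EAdd of expr & expr
| ESub of expr & expr
| ESum of expr & expr.

Fixpoint val (e : expr) (x : seq A) (env : seq nat) : nat :=
  match e with
  | EVar i => nth 0 env i
  | ELift e => val e x (behead env)
  | EOne => 1
  | ELen => size x
  | EInp phi e => phi (onth x (val e x env))
  | EAdd e1 e2 => val e1 x env + val e2 x env
  | ESub e1 e2 => val e1 x env - val e2 x env
  | ESum e1 e2 => \sum_(i < val e1 x env) val e2 x (nat_of_ord i :: env)
  end.

Variable B : finType.

Definition mv (im : option bool) (inc dec : seq nat) : act B :=
  Act im (fun k => if k \in inc then Some true
                   else if k \in dec then Some false else None) None.

Definition move (im : option bool) (inc dec : seq nat) : prog A B :=
  doP (fun=> mv im inc dec).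

(** Depending on the lists, this clears register [k], adds it to other registers, subtracts it from
    them, or moves the input head by its value. *)
Definition sweep (k : nat) (im : option bool) (inc dec : seq nat) : prog A B :=
  whileP (fun v => v.2 k) (move im inc (k :: dec)).

(** Register [b] counts the remaining rounds down while [i] counts up and serves the body as loop
    index; the last sweep resets [i]. *)
Definition forP (b i : nat) (bound body : prog A B) : prog A B :=
  seqP bound
    (seqP (whileP (fun v => v.2 b)
             (seqP (move None [::] [:: b]) (seqP body (move None [:: i] [::]))))
       (sweep i None [::] [::])).

(* Adds the value of the expression to register [t]; the variables are in the
   registers [vs], and the registers from [f] on are free and zero. *)
Fixpoint comp (e : expr) (vs : seq nat) (t f : nat) : prog A B :=
  match e with
  | EVar i =>
      if i < size vs then
        seqP (sweep (nth 0 vs i) None [:: t; f] [::]) (sweep f None [:: nth 0 vs i] [::])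
      else move None [::] [::]
  | ELift e => comp e (behead vs) t f
  | EOne => move None [:: t] [::]
  | ELen =>
      seqP (whileP (fun v => v.1 : bool) (move (Some true) [:: t; f] [::]))
        (sweep f (Some false) [::] [::])
  | EInp phi e =>
      seqP (comp e vs f f.+2)
        (seqP (sweep f (Some true) [:: f.+1] [::])
           (seqP (doP (fun v => mv None (if phi v.1 then [:: t] else [::]) [::]))
              (sweep f.+1 (Some false) [::] [::])))
  | EAdd e1 e2 => seqP (comp e1 vs t f) (comp e2 vs t f)
  | ESub e1 e2 =>
      seqP (comp e1 vs f f.+2)
        (seqP (comp e2 vs f.+1 f.+2)
           (seqP (sweep f.+1 None [::] [:: f]) (sweep f None [:: t] [::])))
  | ESum e1 e2 => forP f f.+1 (comp e1 vs f f.+2) (comp e2 (f.+1 :: vs) t f.+2)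
  end.

Lemma local_move im inc dec : local (move im inc dec).
Proof.
apply: (@local_do _ _ (\max_(k <- inc ++ dec) k).+1) => //= v k le.
have H s : {subset s <= inc ++ dec} -> (k \in s) = false.
  move=> sub; apply/negP => /sub ks; have := @leq_bigmax_seq _ _ xpredT id _ ks isT.
  by rewrite leqNgt le.
by rewrite !H // => j js; rewrite mem_cat js ?orbT.
Qed.

Lemma local_sweep k im inc dec : local (sweep k im inc dec).
Proof.
apply: (@local_while _ _ k.+1) => [v w g /= ->|] //; exact: local_move.
Qed.

Lemma local_for b i bound body : local bound -> local body -> local (forP b i bound body).
Proof.
move=> l1 l2; apply: local_seq => //; apply: local_seq; last exact: local_sweep.
apply: (@local_while _ _ b.+1) => [v w g /= ->|] //.
apply: local_seq; first exact: local_move.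
by apply: local_seq => //; apply: local_move.
Qed.

Lemma local_comp e vs t f : local (comp e vs t f).
Proof.
elim: e vs t f => /=.
- move=> i vs t f; case: ifP => _; last exact: local_move.
  by apply: local_seq; apply: local_sweep.
- by move=> e IH vs t f; apply: IH.
- by move=> *; apply: local_move.
- move=> vs t f; apply: local_seq; last exact: local_sweep.
  by apply: (@local_while _ _ 0) => //; apply: local_move.
- move=> phi e IH vs t f; apply: local_seq => //; apply: local_seq; first exact: local_sweep.
  apply: local_seq; last exact: local_sweep.
  apply: (@local_do _ _ t.+1) => [v w g|[v w] k le] //=.
  by case: (phi v); rewrite ?inE ?orbF ?gtn_eqF.
- by move=> e1 IH1 e2 IH2 vs t f; apply: local_seq.
- move=> e1 IH1 e2 IH2 vs t f; do 2?apply: local_seq => //.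
  by apply: local_seq; apply: local_sweep.
- by move=> e1 IH1 e2 IH2 vs t f; apply: local_for.
Qed.

Definition shift (im : option bool) (z : int) (n : nat) : int :=
  match im with
  | None => z
  | Some true => (z + n%:Z)%R
  | Some false => (z - n%:Z)%R
  end.

Definition addr (r : nat -> nat) (t v : nat) : nat -> nat :=
  fun k => if k == t then r k + v else r k.

Lemma takes_sweep x k im inc dec r z o : k \notin inc ->
  takes x (sweep k im inc dec) (r k * 2).+1 (Store z r o)
    (Store (shift im z (r k))
       (fun j => if j == k then 0 else if j \in inc then r j + r k
                 else if j \in dec then r j - r k else r j) o).
Proof.
move=> nk.
pose S n := Store (shift im z n)
  (fun j => if j == k then r k - n else if j \in inc then r j + n
            else if j \in dec then r j - n else r j) o.
have -> : Store z r o = S 0.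
  congr Store; first by clear; case: im => [[]|] //=; lia.
  by apply: functional_extensionality => j; rewrite addn0 !subn0;
    case: eqP => [->|_]; do ?case: ifP.
rewrite (_ : Store _ _ _ = S (r k)); last by rewrite /S subnn.
apply: takes_loop => [j lt|] /=; last by rewrite eqxx subnn.
rewrite eqxx subn_eq0 -ltnNge; split=> //.
rewrite (_ : S j.+1 = perform (mv im inc (k :: dec)) (S j)); first exact: takes_do.
congr Store; first by rewrite /S /=; clear; case: im => [[]|] /=; lia.
apply: functional_extensionality => i /=; rewrite inE.
case: eqP => [->|_] /=; first by rewrite (negPf nk); lia.
by do ?case: ifP => _; lia.
Qed.

(** The invariant [r j], [o j] describes registers and output after [j] rounds with the two loop
    registers taken as 0; [addr] puts in their actual contents, [v - j.+1] and [j] while the body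
    runs. *)
Lemma takes_for x b i bound body (r : nat -> nat -> nat) (o : nat -> seq B) v n n' :
  b != i -> (forall j, j <= v -> r j b = 0) -> (forall j, j <= v -> r j i = 0) ->
  takes x bound n (Store 0%R (r 0) (o 0)) (Store 0%R (addr (r 0) b v) (o 0)) ->
  (forall j, j < v ->
     takes x body n'
       (Store 0%R (addr (addr (r j) b (v - j.+1)) i j) (o j))
       (Store 0%R (addr (addr (r j.+1) b (v - j.+1)) i j) (o j.+1))) ->
  takes x (forP b i bound body) (n + v * (n' + 5) + 2)
    (Store 0%R (r 0) (o 0)) (Store 0%R (r v) (o v)).
Proof.
move=> nbi rb ri H1 H2.
pose S j := Store 0%R (addr (addr (r j) b (v - j)) i j) (o j).
have S0 : Store 0%R (addr (r 0) b v) (o 0) = S 0.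
  congr Store; apply: functional_extensionality => k; rewrite /addr subn0.
  by case: (k =P i) => [->|] //; rewrite addn0.
have H3 j : j < v -> S j = S j /\ takes x
   (seqP (move None [::] [:: b]) (seqP body (move None [:: i] [::]))) (1 + (n' + 1)) (S j) (S j.+1).
  move=> lt; split=> //.
  set s1 := Store 0%R (addr (addr (r j) b (v - j.+1)) i j) (o j).
  set s2 := Store 0%R (addr (addr (r j.+1) b (v - j.+1)) i j) (o j.+1).
  have e1 : s1 = perform (mv None [::] [:: b]) (S j).
    congr Store; apply: functional_extensionality => k; rewrite /= !inE /addr.
    case: (k =P b) => [->|] //; rewrite (negPf nbi) rb ?(ltnW lt) //; lia.
  have e2 : S j.+1 = perform (mv None [:: i] [::]) s2.
    congr Store; apply: functional_extensionality => k; rewrite /= !inE /addr.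
    by case: (k =P i) => [->|] //; rewrite eq_sym (negPf nbi) ri //; lia.
  apply: takes_seq; first exact: takes_do.
  rewrite -e1; apply: takes_seq; first exact: H2.
  by rewrite e2; apply: takes_do.
pose s3 := Store 0%R (addr (r v) i v) (o v).
have Sv : S v = s3.
  congr Store; apply: functional_extensionality => k; rewrite /addr subnn.
  by case: (k =P b) => [->|] //; rewrite addn0.
rewrite S0 in H1.
have L : takes x (whileP (fun v => v.2 b)
   (seqP (move None [::] [:: b]) (seqP body (move None [:: i] [::]))))
   (v * (1 + (n' + 1)).+1).+1 (S 0) (S v).
  apply: takes_loop => [j lt|] /=; last by rewrite /addr (negPf nbi) eqxx rb // subnn.
  split; last by have [] := H3 j lt.
  by rewrite /addr (negPf nbi) eqxx rb ?(ltnW lt) //; lia.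
have := takes_sweep x (k := i) None (inc := [::]) [::] (addr (r v) i v) 0%R (o v) isT.
rewrite [X in takes _ _ _ _ X](_ : _ = Store 0%R (r v) (o v)); last first.
  congr Store; apply: functional_extensionality => k; rewrite /addr.
  by case: (k =P i) => [->|] //=; rewrite ri.
rewrite -/s3 -Sv /= => Hs.
apply: takes_le (takes_seq H1 (takes_seq L Hs)).
rewrite /addr eqxx ri //; lia.
Qed.

Ltac polyn_tac := repeat first [ assumption | exact: polyn_id | exact: polyn_const
  | apply: polyn_add | apply: polyn_mul ].

Ltac regs_eq := apply: functional_extensionality => ?;
  rewrite /= /addr ?inE /=; repeat (case: eqP => ? /=); subst; lia.

Ltac store_eq := congr Store; try regs_eq; rewrite /= /addr ?inE /=;
  repeat (case: eqP => ? /=); lia.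

(** One polynomial bounds both value and running time, because values become loop lengths. Variables
    are evaluated in [r] while the run starts in [r'], which may differ from [r] outside [vs]. *)
Definition comp_bound (e : expr) (p : nat -> nat) : Prop :=
  forall x vs t f r r' o N, t < f -> t \notin vs -> (forall k, k \in vs -> k < f) ->
    (forall k, f <= k -> r' k = 0) -> size x <= N -> (forall k, k \in vs -> r k <= N) ->
    {in vs, r' =1 r} ->
    val e x (map r vs) <= p N /\
    takes x (comp e vs t f) (p N) (Store 0%R r' o)
      (Store 0%R (addr r' t (val e x (map r vs))) o).

Lemma comp_spec e : exists2 p, polyn p & comp_bound e p.
Proof.
suff [p Pp H] : exists2 p, polyn p &
  forall x vs t f r o N, t < f -> t \notin vs -> (forall k, k \in vs -> k < f) ->
    (forall k, f <= k -> r k = 0) -> size x <= N -> (forall k, k \in vs -> r k <= N) ->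
    val e x (map r vs) <= p N /\
    takes x (comp e vs t f) (p N) (Store 0%R r o)
      (Store 0%R (addr r t (val e x (map r vs))) o).
  exists p => // x vs t f r r' o N tf tvs vsf r0 xN rN er.
  by rewrite -((eq_in_map _ _ _).1 er); apply: H => // k kvs; rewrite er // rN.
elim: e => [i|e [p Pp IH]||| phi e [p Pp IH]|e1 [p1 P1 IH1] e2 [p2 P2 IH2]
           |e1 [p1 P1 IH1] e2 [p2 P2 IH2]|e1 [p1 P1 IH1] e2 [p2 P2 IH2]].
- exists (fun N => N * 4 + 2) => [|x vs t f r o N tf tvs vsf r0 xN rN /=]; first by polyn_tac.
  have [lt|ge] := ltnP; last first.
    rewrite nth_default ?size_map //; split=> //.
    apply: (@takes_le _ _ _ _ 1); first lia.
    rewrite (_ : Store 0%R (addr r t 0) o = perform (mv None [::] [::]) (Store 0%R r o)).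
      exact: takes_do.
    by store_eq.
  rewrite (nth_map 0) //; set v := nth 0 vs i.
  have vvs : v \in vs by apply: mem_nth.
  have lev := rN _ vvs; have vf := vsf _ vvs; have f0 := r0 f (leqnn f).
  have vt : v <> t by move=> e; rewrite -e vvs in tvs.
  split; first lia.
  (* Reading a register empties it, so its content goes to [t] and to the scratch register [f], and
     from [f] back. *)
  have n1 : v \notin [:: t; f] by rewrite !inE; lia.
  have n2 : f \notin [:: v] by rewrite !inE; lia.
  have H1 := takes_sweep x None [::] r 0%R o n1.
  have := takes_seq H1 (takes_sweep x None [::] _ _ _ n2).
  rewrite [X in takes _ _ _ _ X](_ : _ = Store 0%R (addr r t (r v)) o).
    by apply: takes_le; rewrite !inE eqxx orbT; case: eqP; lia.
  by store_eq.
- exists p => // x vs t f r o N tf tvs vsf r0 xN rN /=; rewrite behead_map.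
  have sub : {subset behead vs <= vs} by apply: mem_behead.
  apply: IH => //; first by apply: contra tvs; apply: sub.
    by move=> k /sub; apply: vsf.
  by move=> k /sub; apply: rN.
- exists (fun N => 1) => [|x vs t f r o N tf tvs vsf r0 xN rN /=]; first by polyn_tac.
  split=> //.
  rewrite (_ : Store 0%R (addr r t 1) o = perform (mv None [:: t] [::]) (Store 0%R r o)).
    exact: takes_do.
  by store_eq.
- exists (fun N => N * 4 + 2) => [|x vs t f r o N tf tvs vsf r0 xN rN /=]; first by polyn_tac.
  split; first lia.
  have f0 := r0 f (leqnn f).
  (* While the head crosses the input, [t] collects the length and [f] the distance for the way back
     to cell 0. *)
  pose S j := Store (Posz j) (addr (addr r t j) f j) o.
  have H1 : takes x (whileP (fun v => v.1 : bool) (move (Some true) [:: t; f] [::]))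
      (size x * 2).+1 (S 0) (S (size x)).
    apply: takes_loop => [j lt|]; last by rewrite /= onthTE ltnn.
    split; first by rewrite /= onthTE.
    rewrite (_ : S j.+1 = perform (mv (Some true) [:: t; f] [::]) (S j)); first exact: takes_do.
    by store_eq.
  have := takes_seq H1 (takes_sweep x (k := f) (Some false) (inc := [::]) [::] _ _ _ isT).
  rewrite (_ : S 0 = Store 0%R r o); last by store_eq.
  rewrite [X in takes _ _ _ _ X](_ : _ = Store 0%R (addr r t (size x)) o).
    by apply: takes_le; rewrite /addr eqxx; case: eqP; lia.
  by store_eq.
- exists (fun N => p N + (p N * 2 + 1 + (1 + (p N * 2 + 1)))); first by polyn_tac.
  move=> x vs t f r o N tf tvs vsf r0 xN rN /=.
  have fvs : f \notin vs by apply/negP => /vsf; lia.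
  have [le1 H1] := IH x vs f f.+2 r o N (leqW (ltnSn f)) fvs (fun k h => leqW (leqW (vsf k h)))
     (fun k h => r0 k (ltnW (ltnW h))) xN rN.
  split; first by case: (phi _); lia.
  set v := val e x _ in le1 H1 *.
  have f0 := r0 f (leqnn f); have f1 := r0 f.+1 (leqnSn f).
  have n1 : f \notin [:: f.+1] by rewrite !inE; lia.
  (* The head walks to cell [v], and [f.+1] records the distance for the return. *)
  have := takes_sweep x (Some true) [::] (addr r f v) 0%R o n1.
  rewrite [X in takes _ _ _ _ X](_ : _ = Store (Posz v) (addr r f.+1 v) o); last by store_eq.
  move=> H2.
  set ac := fun w : view A => mv None (if phi w.1 then [:: t] else [::]) [::].
  have H3 : takes x (doP ac) 1 _ _ := takes_do x ac (Store (Posz v) (addr r f.+1 v) o).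
  rewrite [X in takes _ _ _ _ X](_ : _ =
    Store (Posz v) (addr (addr r f.+1 v) t (phi (onth x v))) o) in H3; last first.
    by rewrite /= /ac /=; case: (phi _); store_eq.
  have := takes_seq H1 (takes_seq H2 (takes_seq H3
    (takes_sweep x (k := f.+1) (Some false) (inc := [::]) [::] _ _ _ isT))).
  rewrite [X in takes _ _ _ _ X](_ : _ = Store 0%R (addr r t (phi (onth x v))) o).
    by apply: takes_le; rewrite /addr eqxx; case: eqP => [|_]; first lia; rewrite f0 eqxx f1; nia.
  by store_eq.
- exists (fun N => p1 N + p2 N); first by polyn_tac.
  move=> x vs t f r o N tf tvs vsf r0 xN rN /=.
  have [le1 H1] := IH1 x vs t f r o N tf tvs vsf r0 xN rN.
  set r1 := addr r t _ in H1.
  have er1 : {in vs, r1 =1 r}.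
    by move=> k kvs; rewrite /r1 /addr; case: eqP kvs tvs => // -> ->.
  have [||le2 H2] := IH2 x vs t f r1 o N tf tvs vsf _ xN.
  - by move=> k le; rewrite /r1 /addr gtn_eqF ?r0 //; apply: leq_trans le.
  - by move=> k kvs; rewrite er1 // rN.
  rewrite ((eq_in_map _ _ _).1 er1) in le2 H2.
  split; first exact: leq_add.
  have := takes_seq H1 H2; congr (takes _ _ _ _ _).
  by rewrite /r1; store_eq.
- exists (fun N => p1 N + (p2 N + (p2 N * 2 + 1 + (p1 N * 2 + 1)))); first by polyn_tac.
  move=> x vs t f r o N tf tvs vsf r0 xN rN /=.
  have fvs : f \notin vs by apply/negP => /vsf; lia.
  have fvs1 : f.+1 \notin vs by apply/negP => /vsf; lia.
  have vsf2 k : k \in vs -> k < f.+2 by move=> /vsf; lia.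
  have f0 := r0 f (leqnn f); have f1 := r0 f.+1 (leqnSn f).
  have [le1 H1] := IH1 x vs f f.+2 r o N (leqW (ltnSn f)) fvs vsf2
     (fun k h => r0 k (ltnW (ltnW h))) xN rN.
  set v1 := val e1 x _ in le1 H1 *.
  have er1 : {in vs, addr r f v1 =1 r}.
    by move=> k kvs; rewrite /addr; case: eqP kvs fvs => // -> ->.
  have [||le2 H2] := IH2 x vs f.+1 f.+2 (addr r f v1) o N (ltnSn _) fvs1 vsf2 _ xN.
  - by move=> k le; rewrite /addr r0; [case: eqP; lia|lia].
  - by move=> k kvs; rewrite er1 // rN.
  rewrite ((eq_in_map _ _ _).1 er1) in le2 H2.
  set v2 := val e2 x _ in le2 H2 *.
  split; first lia.
  have n1 : f.+1 \notin [::] by [].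
  have := takes_sweep x None [:: f] (addr (addr r f v1) f.+1 v2) 0%R o n1.
  rewrite [X in takes _ _ _ _ X](_ : _ = Store 0%R (addr r f (v1 - v2)) o); last by store_eq.
  move=> H3.
  have n2 : f \notin [:: t] by rewrite !inE; lia.
  have := takes_seq H1 (takes_seq H2 (takes_seq H3 (takes_sweep x None [::] _ _ _ n2))).
  rewrite [X in takes _ _ _ _ X](_ : _ = Store 0%R (addr r t (v1 - v2)) o).
    by apply: takes_le; rewrite /addr; repeat (case: eqP => ?); lia.
  by store_eq.
(* The summation index is a new variable below [p1 N], so the body is run with the bound
   [N + p1 N]. *)
- exists (fun N => p1 N + p1 N * (p2 (N + p1 N) + 5) + 2).
    have P3 : polyn (fun N => p2 (N + p1 N)).
      by apply: (@polyn_comp p2 (fun N => N + p1 N)) => //; polyn_tac.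
    by polyn_tac.
  move=> x vs t f r o N tf tvs vsf r0 xN rN /=.
  have fvs : f \notin vs by apply/negP => /vsf; lia.
  have fvs1 : f.+1 \notin vs by apply/negP => /vsf; lia.
  have vsf2 k : k \in vs -> k < f.+2 by move=> /vsf; lia.
  have f0 := r0 f (leqnn f); have f1 := r0 f.+1 (leqnSn f).
  have [le1 H1] := IH1 x vs f f.+2 r o N (leqW (ltnSn f)) fvs vsf2
     (fun k h => r0 k (ltnW (ltnW h))) xN rN.
  set v1 := val e1 x _ in le1 H1 *.
  (* The partial sum collected in [t] by the first [j] rounds. *)
  pose w j := \sum_(i < j) val e2 x (nat_of_ord i :: map r vs).
  have H2 j : j < v1 -> val e2 x (j :: map r vs) <= p2 (N + p1 N) /\
     takes x (comp e2 (f.+1 :: vs) t f.+2) (p2 (N + p1 N))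
       (Store 0%R (addr (addr (addr r t (w j)) f (v1 - j.+1)) f.+1 j) o)
       (Store 0%R (addr (addr (addr r t (w j.+1)) f (v1 - j.+1)) f.+1 j) o).
    move=> lt; set r' := addr _ f.+1 j.
    have er' : {in vs, r' =1 r}.
      move=> k kvs; rewrite /r' /addr.
      by do ![case: eqP => [ek|_]; first by move: kvs fvs fvs1 tvs; rewrite ek => ->].
    have tvs' : t \notin f.+1 :: vs by rewrite inE negb_or tvs; lia.
    have vsf' k : k \in f.+1 :: vs -> k < f.+2 by rewrite inE => /orP[/eqP->|/vsf2].
    have xN' : size x <= N + p1 N by lia.
    have tf2 : t < f.+2 by lia.
    have [||le2 H2] := IH2 x (f.+1 :: vs) t f.+2 r' o (N + p1 N) tf2 tvs' vsf' _ xN'.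
    - by move=> k le; rewrite /r' /addr r0; [repeat (case: eqP => ?); lia|lia].
    - move=> k; rewrite inE => /orP[/eqP->|kvs]; last first.
        by rewrite er' // (leq_trans (rN _ kvs)) // leq_addr.
      by rewrite /r' /addr; repeat (case: eqP => ?); lia.
    have er1 : r' f.+1 = j by rewrite /r' /addr; repeat (case: eqP => ?); lia.
    rewrite /= ((eq_in_map _ _ _).1 er') er1 in le2 H2.
    split=> //.
    have -> : w j.+1 = w j + val e2 x (j :: map r vs) by rewrite /w big_ord_recr.
    set V := val e2 x _ in H2 *.
    rewrite (_ : addr (addr (addr r t (w j + V)) f (v1 - j.+1)) f.+1 j = addr r' t V) //.
    rewrite /r'; clear - tf f0 f1; regs_eq.
  split.
    suff : w v1 <= v1 * p2 (N + p1 N) by rewrite /w /=; nia.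
    rewrite -[v1 in v1 * _]card_ord -sum_nat_const; apply: leq_sum => i _.
    by have [] := H2 i (ltn_ord i).
  have w0 : w 0 = 0 by rewrite /w big_ord0.
  have er0 : addr r t (w 0) = r by rewrite w0; regs_eq.
  have := @takes_for x f f.+1 (comp e1 vs f f.+2) (comp e2 (f.+1 :: vs) t f.+2)
    (fun j => addr r t (w j)) (fun=> o) v1 (p1 N) (p2 (N + p1 N)).
  rewrite er0 => /(_ _ _ _ H1) H; apply: takes_le (H _ _ _ _); first nia.
  - lia.
  - by move=> j _; rewrite /addr; case: eqP => ?; lia.
  - by move=> j _; rewrite /addr; case: eqP => ?; lia.
  - by move=> j lt; have [] := H2 j lt.
Qed.

(** * Programs that print a word by nested loops *)

Inductive out :=
| OSym of B
| OSeq of out & out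
| OFor of expr & out.

Fixpoint sem (o : out) (x : seq A) (env : seq nat) : seq B :=
  match o with
  | OSym b => [:: b]
  | OSeq o1 o2 => sem o1 x env ++ sem o2 x env
  | OFor e o => flatten [seq sem o x (i :: env) | i <- iota 0 (val e x env)]
  end.

Fixpoint ocomp (o : out) (vs : seq nat) (f : nat) : prog A B :=
  match o with
  | OSym b => doP (fun=> Act None (fun=> None) (Some b))
  | OSeq o1 o2 => seqP (ocomp o1 vs f) (ocomp o2 vs f)
  | OFor e o => forP f f.+1 (comp e vs f f.+2) (ocomp o (f.+1 :: vs) f.+2)
  end.

Lemma local_ocomp o vs f : local (ocomp o vs f).
Proof.
elim: o vs f => [b|o1 IH1 o2 IH2|e o IH] vs f /=; first exact: (@local_do _ _ 0).
  exact: local_seq.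
apply: local_for => //; exact: local_comp.
Qed.

(** Every printing program restores all registers, so programs can be concatenated and nested with
    the same scratch registers. *)
Lemma ocomp_spec o : exists2 p, polyn p &
  forall x vs f r w N, (forall k, k \in vs -> k < f) ->
    (forall k, f <= k -> r k = 0) -> size x <= N -> (forall k, k \in vs -> r k <= N) ->
    takes x (ocomp o vs f) (p N) (Store 0%R r w) (Store 0%R r (w ++ sem o x (map r vs))).
Proof.
elim: o => [b|o1 [p1 P1 IH1] o2 [p2 P2 IH2]|e o [p P IH]].
- exists (fun=> 1) => [|x vs f r w N vsf r0 xN rN /=]; first exact: polyn_const.
  rewrite cats1 (_ : Store _ _ (rcons _ _) =
    perform (Act None (fun=> None) (Some b)) (Store 0%R r w)) //; exact: takes_do.
- exists (fun N => p1 N + p2 N) => [|x vs f r w N vsf r0 xN rN /=]; first by polyn_tac.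
  by rewrite catA; apply: takes_seq; [apply: IH1 | apply: IH2].
have [q Q H] := comp_spec e.
exists (fun N => q N + q N * (p (N + q N) + 5) + 2).
  have P3 : polyn (fun N => p (N + q N)).
    by apply: (@polyn_comp p (fun N => N + q N)) => //; polyn_tac.
  by polyn_tac.
move=> x vs f r w N vsf r0 xN rN /=.
have fvs : f \notin vs by apply/negP => /vsf; lia.
have fvs1 : f.+1 \notin vs by apply/negP => /vsf; lia.
have vsf2 k : k \in vs -> k < f.+2 by move=> /vsf; lia.
have f0 := r0 f (leqnn f); have f1 := r0 f.+1 (leqnSn f).
have [||le1 H1] := H x vs f f.+2 r r w N (leqW (ltnSn f)) fvs vsf2 _ xN rN.
- by move=> k le; apply: r0; lia.
- by [].
set v := val e x _ in le1 H1 *.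
pose O j := w ++ flatten [seq sem o x (i :: map r vs) | i <- iota 0 j].
have := @takes_for x f f.+1 (comp e vs f f.+2) (ocomp o (f.+1 :: vs) f.+2)
    (fun=> r) O v (q N) (p (N + q N)).
have O0 : O 0 = w by rewrite /O cats0.
have OS j : O j.+1 = O j ++ sem o x (j :: map r vs).
  by rewrite /O -addn1 iotaD map_cat flatten_cat /= add0n cats0 catA.
rewrite O0 => T; apply: takes_le (T _ _ _ H1 _) => //; first nia.
- lia.
move=> j lt; rewrite OS.
set r' := addr _ f.+1 j.
have er' : {in vs, r' =1 r}.
  move=> k kvs; rewrite /r' /addr.
  by do ![case: eqP => [ek|_]; first by move: kvs fvs fvs1; rewrite ek => ->].
have er1 : r' f.+1 = j by rewrite /r' /addr; repeat (case: eqP => ?); lia.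
rewrite -[in sem _ _ _]((eq_in_map _ _ _).1 er') -[in j :: _]er1.
apply: (IH x (f.+1 :: vs) f.+2 r').
- by move=> k; rewrite inE => /orP[/eqP->|/vsf2].
- by move=> k le; rewrite /r' /addr r0; [repeat (case: eqP => ?); lia|lia].
- lia.
- move=> k; rewrite inE => /orP[/eqP->|kvs]; first by rewrite er1; lia.
  by rewrite er' // (leq_trans (rN _ kvs)) // leq_addr.
Qed.

Lemma polytime_sem o : polytime (fun x => sem o x [::]).
Proof.
have [p P H] := ocomp_spec o.
apply: (prog_polytime (local_ocomp o [::] 0) (polyn_bounded P)) => x.
exists (Store 0%R (fun=> 0) (sem o x [::])) => //.
exact: (H x [::] 0 (fun=> 0) [::] (size x)).
Qed.

(** * Closure properties of printable words and expressible functions *)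

Definition outputs (F : seq A -> seq nat -> seq B) : Prop :=
  exists o, forall x env, sem o x env = F x env.

Definition expressible (F : seq A -> seq nat -> nat) : Prop :=
  exists e, forall x env, val e x env = F x env.

Lemma outputs_polytime F : outputs F -> polytime (fun x => F x [::]).
Proof.
move=> [o H]; have [M [i [oo [T [dM li lo pT HT]]]]] := polytime_sem o.
by exists M, i, oo, T; split=> // x; rewrite -H.
Qed.

Lemma outputs_sym b : outputs (fun _ _ => [:: b]).
Proof. by exists (OSym b). Qed.

Lemma outputs_cat F G : outputs F -> outputs G -> outputs (fun x env => F x env ++ G x env).
Proof. by move=> [o1 H1] [o2 H2]; exists (OSeq o1 o2) => x env /=; rewrite H1 H2. Qed.

Lemma outputs_for F G : expressible F -> outputs G ->
  outputs (fun x env => flatten [seq G x (i :: env) | i <- iota 0 (F x env)]).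
Proof.
move=> [e H1] [o H2]; exists (OFor e o) => x env /=; rewrite H1.
by congr flatten; apply: eq_map => i.
Qed.

Lemma expressible_var i : expressible (fun _ env => nth 0 env i).
Proof. by exists (EVar i). Qed.

Lemma expressible_lift F : expressible F -> expressible (fun x env => F x (behead env)).
Proof. by move=> [e H]; exists (ELift e) => x env /=. Qed.

Lemma expressible_size : expressible (fun x _ => size x).
Proof. by exists ELen. Qed.

Lemma expressible_input phi F : expressible F ->
  expressible (fun x env => phi (onth x (F x env)) : bool).
Proof. by move=> [e H]; exists (EInp phi e) => x env /=; rewrite H. Qed.

Lemma expressible_add F G : expressible F -> expressible G ->
  expressible (fun x env => F x env + G x env).
Proof. by move=> [e1 H1] [e2 H2]; exists (EAdd e1 e2) => x env /=; rewrite H1 H2. Qed.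

Lemma expressible_sub F G : expressible F -> expressible G ->
  expressible (fun x env => F x env - G x env).
Proof. by move=> [e1 H1] [e2 H2]; exists (ESub e1 e2) => x env /=; rewrite H1 H2. Qed.

Lemma expressible_sum F G : expressible F -> expressible G ->
  expressible (fun x env => \sum_(i < F x env) G x (nat_of_ord i :: env)).
Proof.
move=> [e1 H1] [e2 H2]; exists (ESum e1 e2) => x env /=; rewrite H1.
exact: eq_bigr.
Qed.

Lemma eq_expressible F G : (forall x env, F x env = G x env) -> expressible F -> expressible G.
Proof. by move=> e [f H]; exists f => x env; rewrite H e. Qed.

Lemma expressible_const c : expressible (fun _ _ => c).
Proof.
elim: c => [|c [e H]]; first by exists (ESub EOne EOne).
by exists (EAdd EOne e) => x env /=; rewrite H.
Qed.

(** A product is a sum of equal terms; the lift hides the summation index from [G]. *)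
Lemma expressible_mul F G : expressible F -> expressible G ->
  expressible (fun x env => F x env * G x env).
Proof.
move=> f g; apply: eq_expressible (expressible_sum f (expressible_lift g)) => x env /=.
by rewrite sum_nat_const card_ord.
Qed.

Lemma expressible_leq F G : expressible F -> expressible G ->
  expressible (fun x env => F x env <= G x env).
Proof.
move=> f g; apply: eq_expressible (expressible_sub (expressible_const 1) (expressible_sub f g)).
by move=> x env; case: leqP; lia.
Qed.

Lemma expressible_and (F G : seq A -> seq nat -> bool) : expressible F -> expressible G ->
  expressible (fun x env => F x env && G x env).
Proof.
by move=> f g; apply: eq_expressible (expressible_mul f g) => x env; rewrite mulnb.
Qed.

Lemma expressible_neg (F : seq A -> seq nat -> bool) : expressible F ->
  expressible (fun x env => ~~ F x env).
Proof.
move=> f; apply: eq_expressible (expressible_sub (expressible_const 1) f) => x env.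
by case: (F x env).
Qed.

Lemma expressible_or (F G : seq A -> seq nat -> bool) : expressible F -> expressible G ->
  expressible (fun x env => F x env || G x env).
Proof.
move=> /expressible_neg f /expressible_neg g.
apply: eq_expressible (expressible_neg (expressible_and f g)) => x env.
by rewrite -negb_or negbK.
Qed.

Lemma expressible_imply (F G : seq A -> seq nat -> bool) : expressible F -> expressible G ->
  expressible (fun x env => F x env ==> G x env).
Proof.
move=> /expressible_neg f g.
by apply: eq_expressible (expressible_or f g) => x env; rewrite implybE.
Qed.

Lemma expressible_eq F G : expressible F -> expressible G ->
  expressible (fun x env => F x env == G x env).
Proof.
move=> f g; apply: eq_expressible (expressible_and (expressible_leq f g) (expressible_leq g f)).
by move=> x env; rewrite eqn_leq.
Qed.

Lemma expressible_if (b : seq A -> seq nat -> bool) F G :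
  expressible b -> expressible F -> expressible G ->
  expressible (fun x env => if b x env then F x env else G x env).
Proof.
move=> eb f g.
apply: eq_expressible (expressible_add (expressible_mul eb f)
  (expressible_mul (expressible_neg eb) g)) => x env.
by case: (b x env) => /=; rewrite ?mul1n ?mul0n ?addn0.
Qed.

(** The quotient counts the [i < F] with [(i + 1) G <= F]; the factor [1 <= G] accounts for division
    by 0 being 0. *)
Lemma expressible_div F G : expressible F -> expressible G ->
  expressible (fun x env => F x env %/ G x env).
Proof.
move=> f g.
have h : expressible (fun x env => \sum_(i < F x env)
    ((nth 0 (nat_of_ord i :: env) 0).+1 * G x env <= F x env)).
  apply: (@expressible_sum F (fun x env =>
    (nth 0 env 0).+1 * G x (behead env) <= F x (behead env))) => //.
  apply: expressible_leq; last exact: expressible_lift.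
  apply: expressible_mul; last exact: expressible_lift.
  exact: (expressible_add (expressible_const 1) (expressible_var 0)).
apply: eq_expressible (expressible_mul (expressible_leq (expressible_const 1) g) h) => x env /=.
case: (posnP (G x env)) => [->|g0]; first by rewrite mul0n divn0.
rewrite mul1n -[RHS]card_ord -sum1_card.
under eq_bigr => i _ do rewrite -leq_divRL //.
rewrite -(big_mkord xpredT (fun i => i < F x env %/ G x env : nat)).
rewrite (big_cat_nat (leq0n _) (leq_div (F x env) (G x env))) //=.
rewrite [X in _ + X]big_nat [X in _ + X]big1 ?addn0; last first.
  by move=> i /andP[le _]; rewrite ltnNge le.
by rewrite big_mkord; apply: eq_bigr => i _; rewrite ltn_ord.
Qed.

Lemma expressible_mod F G : expressible F -> expressible G ->
  expressible (fun x env => F x env %% G x env).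
Proof.
move=> f g.
apply: eq_expressible (expressible_sub f (expressible_mul (expressible_div f g) g)) => x env.
by rewrite {1}(divn_eq (F x env) (G x env)) addKn.
Qed.

Lemma expressible_expn F c : expressible F -> expressible (fun x env => F x env ^ c).
Proof.
move=> f; elim: c => [|c IH]; first exact: expressible_const.
by apply: eq_expressible (expressible_mul f IH) => x env; rewrite expnS.
Qed.

Lemma expressible_forall (I : finType) (b : I -> seq A -> seq nat -> bool) :
  (forall i, expressible (b i)) -> expressible (fun x env => [forall i, b i x env]).
Proof.
move=> eb; have : expressible (fun x env => all (fun i => b i x env) (enum I)).
  elim: (enum I) => [|i s IH]; first exact: (expressible_const true).
  exact: expressible_and.
apply: eq_expressible => x env; congr nat_of_bool.
by apply/allP/forallP => H i; [apply: H; rewrite mem_enum | move=> _; apply: H].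
Qed.

(** The list is fixed, so the lookup unfolds into finitely many conditionals on the index. *)
Lemma expressible_lookup (I : Type) (s : seq I) F (G : I -> seq A -> seq nat -> nat) :
  expressible F -> (forall i, expressible (G i)) ->
  expressible (fun x env => if onth s (F x env) is Some i then G i x env else 0).
Proof.
move=> f g; elim: s F f => [|i s IH] F f.
  apply: (@eq_expressible (fun _ _ => 0)) => [x env|]; first by rewrite onth0n.
  exact: expressible_const.
have := expressible_if (expressible_eq f (expressible_const 0)) (g i)
  (IH _ (expressible_sub f (expressible_const 1))).
by apply: eq_expressible => x env /=; case: (F x env) => //= n; rewrite subn1.
Qed.
End Expr.

(** * From paths avoiding conflicts to locally rainbow paths *)

Section Rainbow.
Variables (V C : eqType) (r : nat) (c : V -> C).

Lemma rainbow_suffix p q : rainbow r c (p ++ q) -> rainbow r c q.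
Proof.
move=> H i lt; have := H (size p + i).
rewrite size_cat -addnA ltn_add2l => /(_ lt).
by rewrite drop_cat ltnNge leq_addr addKn.
Qed.

(** Colours are constrained only within a full window of [r + 1] vertices; the size hypothesis
    provides one. *)
Lemma rainbow_skip x y z p : 1 < r -> r < (size p).+3 ->
  rainbow r c [:: x, y, z & p] -> c x != c z.
Proof.
move=> r2 sz /(_ 0 sz); case: r r2 => [|[|r']] //= _.
by rewrite !inE !negb_or => /andP[/and3P[]].
Qed.

Lemma rainbow_nth x0 p :
  (forall i k, i < k -> k < size p -> k <= i + r -> c (nth x0 p i) <> c (nth x0 p k)) ->
  rainbow r c p.
Proof.
move=> H i lt.
have sz : size (take r.+1 (drop i p)) = r.+1 by rewrite size_take size_drop; case: ifP; lia.
rewrite uniq_pairwise; apply/(pairwiseP (c x0)) => j k.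
rewrite !inE size_map sz => jr kr jk.
rewrite !(nth_map x0) ?sz // !nth_take // !nth_drop; apply/eqP.
by apply: H; lia.
Qed.
End Rainbow.

(** * The digraph of segments, and reading an avoiding path off a rainbow path *)

Section Graph.
Variables (r m : nat) (first last : nat -> bool) (succ conf : nat -> nat -> bool).

(** Conflicts are tested with the smaller item first. Items of a run will be numbered increasingly
    in time, so this means the earlier one first. *)
Definition avoiding_path : Prop :=
  exists o os, [/\ first o, path succ o os, last (seq.last o os),
    forall a, a \in o :: os -> a < m &
    forall a b, a \in o :: os -> b \in o :: os -> a < b -> ~~ conf a b].

Local Notation vert := (nat * nat * nat)%type.

Definition vs : vert := (0, 0, 0).
Definition vt : vert := (0, 0, 1).

(* The middle vertex of a segment, shared by the segments of a conflicting pair. *)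
Definition can (o o' : nat) : nat * nat :=
  if (o' < o) && conf o' o then (o', o) else (o, o').

(** The third coordinate is a level: 0 for the source, 1 for the target, 2 for the entry of a
    segment, 3 for its middle, 4 to [r + 4] for the spacers. The last spacer leads to the next
    segment of the same item; after the last segment it leads to a successor item or to the
    target. *)
Definition varc (u v : vert) : bool :=
  let: (o, o', j) := u in
  let: (p, p', k) := v in
  if j == 0 then [&& o == 0, o' == 0, k == 2, p' == 0 & first p]
  else if j == 1 then false
  else if j == 2 then (k == 3) && ((p, p') == can o o')
  else if j == 3 then (k == 4) && ((o, o') == can p p')
  else if j < r + 4 then [&& k == j.+1, p == o & p' == o']
  else if o'.+1 < m then [&& k == 2, p == o & p' == o'.+1]
  else [&& k == 2, p' == 0 & succ o p] || [&& k == 1, p == 0, p' == 0 & last o].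

(** The colour is the level, with 2 and 4 exchanged on segments where [o' < o]. Thus the entry of
    [(o, o')] has the colour of level 4 of [(o', o)]. *)
Definition label (u : vert) : nat :=
  let: (o, o', j) := u in if (o' < o) && (j <= 4) then 6 - j else j.

Definition spacers (o o' i : nat) : seq vert := [seq (o, o', j) | j <- iota i (r + 5 - i)].

Definition segment (o o' : nat) : seq vert :=
  [:: (o, o', 2), (can o o', 3) & spacers o o' 4].

Definition segments (o i : nat) : seq vert :=
  flatten [seq segment o o' | o' <- iota i (m - i)].

Hypotheses (r2 : 2 <= r) (m0 : 0 < m).

Lemma spacers_cons o o' i : i < r + 5 -> spacers o o' i = (o, o', i) :: spacers o o' i.+1.
Proof. by move=> lt; rewrite /spacers (_ : r + 5 - i = (r + 5 - i.+1).+1) //; lia. Qed.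

Lemma segments_cons o i : i < m -> segments o i = segment o i ++ segments o i.+1.
Proof. by move=> lt; rewrite /segments (_ : m - i = (m - i.+1).+1) //; lia. Qed.

Lemma segments_end o i : m <= i -> segments o i = [::].
Proof. by rewrite /segments -subn_eq0 => /eqP->. Qed.

(** Each spacer before the last has a single out-neighbour, and the path cannot stop there since it
    ends in [vt]. *)
Lemma follow_spacers o o' i p : 4 <= i <= r + 4 ->
  path varc (o, o', i) p -> seq.last (o, o', i) p = vt ->
  exists2 q, p = spacers o o' i.+1 ++ q & path varc (o, o', r + 4) q /\
     seq.last (o, o', r + 4) q = vt.
Proof.
move: {2}(r + 4 - i) (leqnn (r + 4 - i)) => n.
elim: n i p => [|n IH] i p lein /andP[le4 le] pp lp.
  have e : i = r + 4 by lia.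
  exists p; last by rewrite -e.
  by rewrite /spacers (_ : r + 5 - i.+1 = 0) //; lia.
have [e|lt] : i = r + 4 \/ i < r + 4 by lia.
  exists p; last by rewrite -e.
  by rewrite /spacers (_ : r + 5 - i.+1 = 0) //; lia.
case: p pp lp => [_ [] //|[[a a'] k] p]; first by lia.
rewrite [path _ _ _]/= => /andP[].
do 4!(rewrite ifF; last by lia); rewrite lt => /and3P[/eqP-> /eqP-> /eqP->] pp lp.
have [||q -> Hq] := IH i.+1 p _ _ pp lp; try lia.
by exists q => //; rewrite (@spacers_cons _ _ i.+1) //; lia.
Qed.

(** The only other exit from the middle vertex is into segment [(o', o)], whose vertex at level 4
    has the colour of the entry, two steps back. The spacers that must follow complete the window,
    so the rainbow condition really applies. *)
Lemma follow_segment o o' p : path varc (o, o', 2) p -> seq.last (o, o', 2) p = vt ->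
  rainbow r label ((o, o', 2) :: p) ->
  exists2 q, (o, o', 2) :: p = segment o o' ++ q & path varc (o, o', r + 4) q /\
     seq.last (o, o', r + 4) q = vt.
Proof.
case: p => [//|[[c c'] k] p] /= /andP[/andP[/eqP-> /eqP ec]].
rewrite ec; case ecan : (can o o') => [d d'].
case: p => [//|[[a a'] k'] p] /= /andP[/andP[/eqP-> /eqP ea]] pp lp rb.
have le4 : 4 <= 4 <= r + 4 by lia.
have [q ep Hq] := follow_spacers le4 pp lp.
suff [ea1 ea2] : a = o /\ a' = o'.
  exists q; last by rewrite -ea1 -ea2.
  by rewrite /segment ?ecan -ea1 -ea2 ep (@spacers_cons _ _ 4) //; lia.
have /eqP : label (o, o', 2) != label (a, a', 4).
  apply: (rainbow_skip _ _ rb) => //.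
  by rewrite ep size_cat size_map size_iota; lia.
have [//|[-> [-> ne]]] : (a = o /\ a' = o') \/ (a = o' /\ a' = o /\ o <> o').
  move: ea ecan; rewrite /can.
  by case: ifP => [/andP[l1 _]|_] [-> ->]; case: ifP => [/andP[l2 _]|_] [? ?]; lia.
by rewrite /label; case: (ltngtP o o') ne.
Qed.

Definition track o := segments o 0.

Lemma follow_track o i p : i < m -> path varc (o, i, 2) p -> seq.last (o, i, 2) p = vt ->
  rainbow r label ((o, i, 2) :: p) ->
  exists2 q, (o, i, 2) :: p = segments o i ++ q & path varc (o, m.-1, r + 4) q /\
     seq.last (o, m.-1, r + 4) q = vt.
Proof.
move: {2}(m - i) (leqnn (m - i)) => n; elim: n i p => [|n IH] i p; first by lia.
move=> lein lt pp lp rb; have [q ep [pq lq]] := follow_segment pp lp rb.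
have [e|lt2] : i = m.-1 \/ i.+1 < m by lia.
  exists q; last by rewrite -e.
  by rewrite segments_cons // segments_end ?cats0 //; lia.
case: q ep pq lq => [_ _ [] //|[[a a'] k] q] ep; first by lia.
rewrite [path _ _ _]/= => /andP[].
do 4!(rewrite ifF; last by lia); rewrite ifF; last by lia.
rewrite lt2 => /and3P[/eqP ek /eqP ea /eqP ea']; subst a a' k => pq lq.
have rq : rainbow r label ((o, i.+1, 2) :: q).
  by apply: (@rainbow_suffix _ _ _ _ (segment o i)); rewrite -ep.
have [|q' eq Hq] := IH i.+1 q _ lt2 pq lq rq; first by lia.
by exists q' => //; rewrite ep eq (segments_cons o lt) catA.
Qed.

(** Induction on the length: after a full track the path enters the track of a successor or reaches
    [vt], which has no out-arcs. *)
Lemma follow_tracks o p : path varc (o, 0, 2) p -> seq.last (o, 0, 2) p = vt ->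
  rainbow r label ((o, 0, 2) :: p) ->
  exists os, [/\ (o, 0, 2) :: p = flatten [seq track a | a <- o :: os] ++ [:: vt],
    path succ o os & last (seq.last o os)].
Proof.
move: {2}(size p) (leqnn (size p)) => n; elim: n o p => [|n IH] o p.
  by case: p => // _ _ [].
move=> sz pp lp rb; have [q ep [pq lq]] := follow_track m0 pp lp rb.
case: q ep pq lq => [_ _ [] //|[[a a'] k] q] ep; first by lia.
rewrite [path _ _ _]/= => /andP[].
do 4!(rewrite ifF; last by lia); rewrite ifF; last by lia.
rewrite ifF; last by lia.
case/orP.
  case/and3P=> /eqP ek /eqP ea' so; subst a' k => pq lq.
  have rq : rainbow r label ((a, 0, 2) :: q).
    by apply: (@rainbow_suffix _ _ _ _ (segments o 0)); rewrite -ep.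
  have [|os [eq pos los]] := IH a q _ pq lq rq.
    move: (congr1 size ep); rewrite size_cat (segments_cons _ m0) /=; lia.
  exists (a :: os); split=> //=; last by rewrite so.
  by rewrite ep eq /= catA.
case/and4P=> /eqP ek /eqP ea /eqP ea' lo; subst a a' k.
case: q ep => [|[[? ?] ?] q] //= ep _ _; exists [::]; split=> //=.
by rewrite ep cats0.
Qed.

Lemma mem_segments_pair o o' : o' < m -> (can o o', 3) \in track o.
Proof.
move=> lt; apply/flattenP; exists (segment o o').
  by apply/mapP; exists o' => //; rewrite mem_iota; lia.
by rewrite !inE eqxx orbT.
Qed.

Lemma flatten_disjoint (T : eqType) (I : eqType) (f : I -> seq T) (s : seq I) a b x :
  uniq (flatten (map f s)) -> a \in s -> b \in s -> a != b -> x \in f a -> x \in f b -> False.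
Proof.
elim: s => //= i s IH; rewrite cat_uniq => /and3P[_ /hasPn H u].
rewrite !inE => /orP[/eqP-> | a1] /orP[/eqP->|b1] ne xa xb.
- by rewrite eqxx in ne.
- have : x \in flatten (map f s) by apply/flattenP; exists (f b) => //; apply: map_f.
  by move/H; rewrite /= xa.
- have : x \in flatten (map f s) by apply/flattenP; exists (f a) => //; apply: map_f.
  by move/H; rewrite /= xb.
exact: IH.
Qed.

Lemma avoiding_path_of_graph p :
  path varc vs p -> uniq (vs :: p) -> seq.last vs p = vt -> rainbow r label (vs :: p) ->
  (forall u, u \in p -> u.1.1 < m) -> avoiding_path.
Proof.
case: p => [|[[o a'] k] p]; first by [].
rewrite [path _ _ _]/= => /andP[/and3P[/eqP-> /eqP-> fo]] pp up lp rb rg.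
have rp : rainbow r label ((o, 0, 2) :: p) by apply: (@rainbow_suffix _ _ _ _ [:: vs]).
have [os [ep pos los]] := follow_tracks pp lp rp.
have lem a : a \in o :: os -> a < m.
  move=> aos; apply: (rg (a, 0, 2)); rewrite ep mem_cat; apply/orP; left.
  apply/flattenP; exists (track a); first exact: map_f.
  by rewrite /track segments_cons // inE eqxx.
exists o, os; split=> // a b aos bos lt; apply/negP => cab.
(* The tracks on a simple path are disjoint, whereas those of conflicting items share the vertex
   [can a b] at level 3. *)
have : uniq (flatten [seq track a | a <- o :: os]).
  by move: up; rewrite cons_uniq ep cat_uniq => /and3P[_ ->].
move/flatten_disjoint => /(_ a b (can a b, 3) aos bos).
apply; first by rewrite ltn_eqF.
  by apply: mem_segments_pair; apply: lem.
rewrite (_ : can a b = can b a); first by apply: mem_segments_pair; apply: lem.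
by rewrite /can lt cab ltnNge ltnW.
Qed.

(** * The rainbow path through the tracks of an avoiding path *)

Section Forward.
Variables (o0 : nat) (os0 : seq nat).
Let os := o0 :: os0.
Let S := r + 3.
Let T := size os * m * S.

Hypothesis succ_lt : forall a b, succ a b -> a < b.
Hypotheses (fo : first o0) (po : path succ o0 os0) (lo : last (seq.last o0 os0)).
Hypothesis os_lt : forall a, a \in os -> a < m.
Hypothesis os_free : forall a b, a \in os -> b \in os -> a < b -> ~~ conf a b.

(** Here [j] is the position within a segment, two less than the level. *)
Definition tour_vertex (a o' j : nat) : vert :=
  if j == 1 then (can (nth 0 os a) o', 3) else (nth 0 os a, o', j.+2).

(** A segment has [S] vertices and a track [m] segments, so the index is read in mixed radix. *)
Definition tour (i : nat) : vert := tour_vertex (i %/ S %/ m) (i %/ S %% m) (i %% S).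

Definition tour_path : seq vert := rcons (mkseq tour T) vt.

Lemma tourE a o' j : o' < m -> j < S -> tour ((a * m + o') * S + j) = tour_vertex a o' j.
Proof.
move=> lt1 lt2; have S0 : 0 < S by rewrite /S; lia.
by rewrite /tour divnMDl // modnMDl (divn_small lt2) (modn_small lt2) addn0
  divnMDl // modnMDl (divn_small lt1) (modn_small lt1) addn0.
Qed.

Lemma tour_index i : exists a o' j, [/\ o' < m, j < S & i = (a * m + o') * S + j].
Proof.
have S0 : 0 < S by rewrite /S; lia.
exists (i %/ S %/ m), (i %/ S %% m), (i %% S).
by rewrite !ltn_mod; split=> //; rewrite -!divn_eq.
Qed.

Lemma tour_index_lt a o' j n : o' < m -> (a * m + o') * S + j < n * m * S -> a < n.
Proof.
move=> lt H; have S0 : 0 < S by rewrite /S; lia.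
rewrite ltnNge; apply/negP => le.
have : n * m * S <= a * m * S by rewrite !leq_mul.
by rewrite leqNgt (leq_ltn_trans _ H) // mulnDl -addnA leq_addr.
Qed.

Lemma nth_succ a : a.+1 < size os -> succ (nth 0 os a) (nth 0 os a.+1).
Proof. by move=> lt; have /(pathP 0) := po; apply. Qed.

Lemma os_uniq : uniq os.
Proof.
apply: (sorted_uniq ltn_trans ltnn).
by apply: (sub_path (e := succ)) po => a b; apply: succ_lt.
Qed.

Lemma varc_segment a o' j : j.+1 < S -> varc (tour_vertex a o' j) (tour_vertex a o' j.+1).
Proof.
rewrite /S => lt; case: j lt => [|[|j]] lt; rewrite /tour_vertex /=.
- by case: (can _ _) => p p' /=.
- by case: (can _ _) => p p' /=; rewrite eqxx.
- rewrite ifT; last lia.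
  by rewrite !eqxx.
Qed.

Lemma tour_step i : i.+1 < T -> varc (tour i) (tour i.+1).
Proof.
have [a [o' [j [lt1 lt2 ->]]]] := tour_index i.
have S0 : 0 < S by rewrite /S; lia.
move=> ltT; have [lt|e] : j.+1 < S \/ j.+1 = S by lia.
  by rewrite -addnS !tourE //; apply: varc_segment.
have {1}-> : j = r + 2 by rewrite /S in e; lia.
rewrite tourE //; last by rewrite /S; lia.
have [lt|e'] : o'.+1 < m \/ o'.+1 = m by lia.
  rewrite (_ : ((a * m + o') * S + j).+1 = (a * m + o'.+1) * S + 0); last by rewrite -addnS e; nia.
  rewrite tourE // /tour_vertex /= addn2 /=.
  by rewrite ifF; [rewrite lt !eqxx | lia].
have eN : ((a * m + o') * S + j).+1 = (a.+1 * m + 0) * S + 0 by rewrite -addnS e -e'; nia.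
rewrite eN in ltT *; have lta := tour_index_lt m0 ltT.
rewrite tourE // /tour_vertex /= addn2 /=.
rewrite ifF; last by lia.
rewrite ifF; last by lia.
by rewrite nth_succ.
Qed.

Lemma tour_path_arcs : path varc vs tour_path /\ seq.last vs tour_path = vt.
Proof.
have S0 : 0 < S by rewrite /S; lia.
have T0 : 0 < T by rewrite /T !muln_gt0 /= m0.
split; last by rewrite last_rcons.
rewrite /tour_path rcons_path; apply/andP; split.
  apply/(pathP vs) => i; rewrite size_mkseq => lt.
  rewrite nth_mkseq //; case: i lt => [|i] lt; last first.
    rewrite -[nth vs (vs :: _) _]/(nth vs (mkseq tour T) i) nth_mkseq ?(ltnW lt) //.
    exact: tour_step.
  have := @tourE 0 0 0 m0 S0; rewrite /= => ->.
  by rewrite /tour_vertex /=.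
rewrite -nth_last nth_mkseq ?size_mkseq ?prednK //.
rewrite (_ : T.-1 = ((size os).-1 * m + m.-1) * S + (r + 2)); last first.
  rewrite /T /S /=; have -> : m = m.-1.+1 by lia.
  by rewrite /=; nia.
rewrite tourE; [|lia|by rewrite /S; lia].
rewrite /tour_vertex /= addn2 /=.
rewrite ifF; last by lia.
rewrite ifF; last by lia.
by move: lo; rewrite (last_nth 0).
Qed.

(** Off the middle level a vertex determines item, segment and position. Two different segments
    share a middle only if their items conflict, which [os_free] excludes. *)
Lemma tour_inj i k : i < T -> k < T -> tour i = tour k -> i = k.
Proof.
have [a [o' [j [lt1 lt2 ->]]]] := tour_index i.
have [b [p' [l [lt3 lt4 ->]]]] := tour_index k.
move=> /(tour_index_lt lt1) lta /(tour_index_lt lt3) ltb.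
rewrite !tourE //; set o := nth 0 os a; set p := nth 0 os b.
have oin : o \in os by apply: mem_nth.
have pin : p \in os by apply: mem_nth.
rewrite /tour_vertex -/o -/p.
have ab : o = p -> a = b.
  by move=> e; apply/eqP; rewrite -(nth_uniq 0 lta ltb os_uniq); apply/eqP.
case: (j =P 1) => [->|nj]; case: (l =P 1) => [->|nl]; last 1 first.
- by case=> /ab-> -> ->.
- case; rewrite /can; case: ifP => [/andP[c1 c2]|_]; case: ifP => [/andP[c3 c4]|_] [] e1 e2.
  + by rewrite (ab e2) e1.
  + by have := os_free pin oin; rewrite e1 e2 in c1 c2 *; rewrite c1 c2 => /(_ isT).
  + by have := os_free oin pin; rewrite -e1 -e2 in c3 c4 *; rewrite c3 c4 => /(_ isT).
  + by rewrite (ab e1) e2.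
- by case: (can _ _) => ? ? [_ _ []]; lia.
- by case: (can _ _) => ? ? [_ _ []]; lia.
Qed.

Lemma tour_range i : i < T -> [/\ (tour i).1.1 < m, (tour i).1.2 < m & 1 < (tour i).2 < r + 5].
Proof.
have [a [o' [j [lt1 lt2 ->]]]] := tour_index i.
move=> /(tour_index_lt lt1) lta; rewrite tourE //.
have om : nth 0 os a < m by apply/os_lt/mem_nth.
rewrite /tour_vertex /can; case: eqP => _; last by split=> //=; rewrite /S in lt2; lia.
by case: ifP => _ /=; split=> //; lia.
Qed.

Lemma tour_path_uniq : uniq (vs :: tour_path).
Proof.
have notin u : u.2 < 2 -> u \notin mkseq tour T.
  move=> lt; apply/mapP => -[i]; rewrite mem_iota add0n => /andP[_ lti] eu.
  by have [_ _ /andP[]] := tour_range lti; rewrite -eu ltnNge -ltnS lt.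
rewrite cons_uniq /tour_path rcons_uniq mem_rcons inE !negb_or !notin //=.
rewrite map_inj_in_uniq ?iota_uniq // => i k; rewrite !mem_iota !add0n => lti ltk.
exact: tour_inj.
Qed.

Lemma tour_label a o' j : label (tour_vertex a o' j) =
  if (o' < nth 0 os a) && (j <= 2) then 4 - j else j.+2.
Proof.
rewrite /tour_vertex /label; case: (j =P 1) => [->|nj].
  by case: (can _ _) => p p' /=; do 2 case: ifP.
by rewrite !ltnS subSS subSS.
Qed.

(** The colours along a segment are 2, 3, 4 in one of the two directions, then 5 up to [r + 4].
    Vertices at distance at most [r] lie in one segment or in two consecutive ones. *)
Lemma tour_path_rainbow : rainbow r label (vs :: tour_path).
Proof.
apply: (@rainbow_nth _ _ _ _ vs) => i k lt1.
(* The colours 0 and 1 occur only at the source and the target. *)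
have lab l : l < T -> 1 < label (tour l).
  have [a [o' [j [ltm ltS ->]]]] := tour_index l => _; rewrite tourE // tour_label.
  by case: ifP; lia.
have nthE l : nth vs (vs :: tour_path) l =
    if l is l'.+1 then (if l' < T then tour l' else if l' == T then vt else vs) else vs.
  case: l => //= l; rewrite nth_rcons size_mkseq; case: ifP => // ltT.
  by rewrite nth_mkseq.
rewrite !nthE /= size_rcons size_mkseq; case: k lt1 => // k lt1 ltk le.
case: i lt1 le => [|i] lt1 le.
  case: ifP => [/lab|nlt]; first by case: label => [|[]].
  by rewrite ifT //; lia.
have ltiT : i < T by lia.
rewrite ltiT; case: ltnP => [ltkT|leT]; last first.
  by rewrite ifT; [have := lab _ ltiT; rewrite /label /=; lia | lia].
move: lt1 le {ltk ltkT ltiT}.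
have [a [o' [j [ltm ltS ->]]]] := tour_index i.
have [b [p' [l [ltm' ltS' ->]]]] := tour_index k.
rewrite !tourE // !tour_label.
set q := a * m + o'; set q' := b * m + p'; move=> lt1 le.
have [eq|eq] : q = q' \/ q' = q.+1 by move: lt1 le ltS ltS'; rewrite /S; nia.
  have ea : a = b.
    by have := congr1 (divn^~ m) eq; rewrite /= /q /q' !divnMDl // !divn_small // !addn0.
  have eo : o' = p' by move: eq; rewrite /q /q' ea => /addnI.
  rewrite ea eo; rewrite eq in lt1.
  by case: (p' < _) => /=; do ?case: ifP; lia.
rewrite eq in le; move: ltS ltS' le; rewrite /S mulSn => ltS ltS' le.
(* Across a border the earlier vertex has position [j >= 3], hence colour [j + 2 >= 5]; the later
   one has colour at most 4 or [l + 2 < j + 2]. *)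
have {}le : l + 3 <= j by lia.
do 2!case: ifP; lia.
Qed.

Lemma graph_of_avoiding_path : exists p,
  [/\ path varc vs p, uniq (vs :: p), seq.last vs p = vt, rainbow r label (vs :: p) &
      forall u, u \in p -> [/\ u.1.1 < m, u.1.2 < m & u.2 < r + 5]].
Proof.
exists tour_path; have [? ?] := tour_path_arcs; split=> //.
- exact: tour_path_uniq.
- exact: tour_path_rainbow.
move=> u; rewrite mem_rcons inE => /orP[/eqP->|]; first by rewrite /= m0; split=> //; lia.
case/mapP=> i; rewrite mem_iota add0n => /andP[_ lti] ->.
by have [? ? /andP[]] := tour_range lti.
Qed.
End Forward.
End Graph.

(** * From machine runs to paths avoiding conflicts *)

(** The successor of the greatest [j < i] with [p j], which leaves 0 free to say that there is
    none. *)
Fixpoint last_below (p : pred nat) (i : nat) : nat :=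
  if i is j.+1 then if p j then j.+1 else last_below p j else 0.

Lemma last_below_le (p : pred nat) i : last_below p i <= i.
Proof. by elim: i => //= i IH; case: ifP => // _; apply: leqW. Qed.

Lemma last_below_ge (p : pred nat) i j : j < i -> p j -> j < last_below p i.
Proof.
elim: i => //= i IH; rewrite ltnS leq_eqVlt => /orP[/eqP-> ->//|lt pj].
by case: ifP => // _; [apply: leqW | apply: IH].
Qed.

Lemma last_below_holds (p : pred nat) i j : last_below p i = j.+1 -> p j.
Proof. by elim: i => //= i IH; case: ifP => // pi [<-]. Qed.

(** The three hypotheses are what the pairwise checks on items yield for a claimed last visit. *)
Lemma last_below_unique (p : pred nat) i v : v <= i -> (forall j, j < i -> p j -> j < v) ->
  (forall j, v = j.+1 -> p j) -> last_below p i = v.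
Proof.
move=> le ge hold; apply/eqP; rewrite eqn_leq; apply/andP; split.
  have := @last_below_holds p i; have := last_below_le p i.
  by case: last_below => // j lt /(_ _ erefl); apply: ge.
by case: v le hold {ge} => // j lt /(_ _ erefl); apply: last_below_ge.
Qed.

Fixpoint digits (b : nat) (g : nat -> nat) (n : nat) : nat :=
  if n is n'.+1 then digits b g n' + g n' * b ^ n' else 0.

Lemma digits_lt b g n : (forall j, g j < b) -> digits b g n < b ^ n.
Proof.
move=> gb; elim: n => //= n IH; rewrite expnS.
apply: (@leq_trans (b ^ n + g n * b ^ n)); first by rewrite ltn_add2r.
by rewrite -mulSn leq_mul2r gb orbT.
Qed.

Lemma digits_top b g n t : (forall j, g j < b) -> (digits b g n + t * b ^ n) %/ b ^ n = t.
Proof.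
move=> gb; have lt := digits_lt n gb.
by rewrite addnC divnMDl ?(leq_ltn_trans _ lt) // divn_small ?addn0.
Qed.

Lemma digitsE b g n t j : (forall j, g j < b) -> j < n ->
  (digits b g n + t * b ^ n) %/ b ^ j %% b = g j.
Proof.
move=> gb; elim: n t => // n IH t; rewrite ltnS leq_eqVlt => /orP[/eqP->|lt].
  by rewrite /= -addnA expnS mulnA -mulnDl digits_top // addnC modnMDl modn_small.
by rewrite /= -addnA expnS mulnA -mulnDl IH.
Qed.

Section Runs.
Variable M : machine.
Local Notation K := (work M).+1.
Local Notation action := (state M * {ffun 'I_K -> symbol M * option bool})%type.

Lemma reaches_seq (C : nat -> config M) (a : nat -> action) n :
  (forall i, i < n -> a i \in delta (cstate (C i)) (scanned (C i))) ->
  (forall i, i < n -> C i.+1 = apply_action (C i) (a i)) -> reaches n (C 0) (C n).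
Proof.
elim: n C a => [|n IH] C a Ha HC; first exact: reaches0.
apply: (reachesS (Ha 0 isT)); rewrite -HC //.
by apply: (IH (C \o succn) (a \o succn)) => i lt; [apply: Ha | apply: HC].
Qed.

Lemma seq_of_reaches (a0 : action) n (c c' : config M) : reaches n c c' ->
  exists (C : nat -> config M) (a : nat -> action), [/\ C 0 = c, C n = c',
    forall i, i < n -> a i \in delta (cstate (C i)) (scanned (C i)) &
    forall i, i < n -> C i.+1 = apply_action (C i) (a i)].
Proof.
elim=> {n c c'} [c|n c b c' bd _ [C [a [C0 Cn Ha HC]]]].
  by exists (fun=> c), (fun=> a0).
exists (fun i => if i is j.+1 then C j else c), (fun i => if i is j.+1 then a j else b).
split=> //; first by case=> // i; apply: Ha.
by case=> [|i] /=; [rewrite C0 | apply: HC].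
Qed.

(** This is why items need no tape contents: the last visit to a cell determines its symbol. *)
Lemma tape_content (C : nat -> config M) (a : nat -> action) n :
  (forall i, i < n -> C i.+1 = apply_action (C i) (a i)) ->
  forall i k z, i <= n -> ctape (C i) k z =
    if last_below (fun j => chead (C j) k == z) i is j.+1 then ((a j).2 k).1
    else ctape (C 0) k z.
Proof.
move=> HC; elim=> [//|i IH] k z lt; rewrite HC //= eq_sym.
by case: ifP => // _; apply/IH/ltnW.
Qed.

(** A head moves at most one cell per step, so a shift by [n] makes all positions natural
    numbers. *)
Lemma head_bound (C : nat -> config M) (a : nat -> action) n :
  (forall k, chead (C 0) k = 0%R) ->
  (forall i, i < n -> C i.+1 = apply_action (C i) (a i)) ->
  forall i k, i <= n ->
    exists2 h : nat, (chead (C i) k + n%:Z)%R = Posz h & h <= n + i /\ n <= h + i.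
Proof.
move=> H0 HC; suff H i k : i <= n -> (- i%:Z <= chead (C i) k <= i%:Z)%R.
  move=> i k le; exists (absz (chead (C i) k + n%:Z)%R); have := H i k le; lia.
elim: i => [|i IH] lt; first by rewrite H0; lia.
have := IH (ltnW lt); rewrite HC //=.
by case: (((a i).2 k).2) => [[]|] /=; lia.
Qed.

Variables (A : finType) (inj : A -> symbol M).

Definition info : finType :=
  (state M * {ffun 'I_K -> symbol M} * (state M * {ffun 'I_K -> symbol M * option bool}))%type.

Definition info0 : info :=
  (start M, [ffun=> blank M], (start M, [ffun=> (blank M, None)])).

Section Items.
Variables (P : nat) (x : seq A).

(* An item records one step of a run: its time, the local information, and for
   every tape the head position, shifted by [P], and the last time (plus one) at
   which that position was visited, or 0.  It is coded as a number in mixed radix,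
   time being most significant. *)
Definition radix := P.*2.+2.
Definition item_info (o : nat) : option info := onth (enum info) (o %% #|info|).
Definition item_digit (j o : nat) : nat := o %/ #|info| %/ radix ^ j %% radix.
Definition item_head (k : 'I_K) := item_digit k.*2.
Definition item_visit (k : 'I_K) := item_digit k.*2.+1.
Definition item_time (o : nat) : nat := o %/ #|info| %/ radix ^ K.*2.
(** Two digits per tape and one for the time. *)
Definition item_number : nat := #|info| * radix ^ K.*2.+1.

Definition initial (k : 'I_K) (h : nat) : symbol M :=
  if (k == ord0) && (P <= h) then odflt (blank M) (omap inj (onth x (h - P))) else blank M.

(** Visit 0 claims that the cell is scanned for the first time, so its symbol must be the initial
    one. *)
Definition well_founded_item (f : info) (o : nat) : bool :=
  [forall k, (item_visit k o <= item_time o) &&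
     ((item_visit k o == 0) ==> (initial k (item_head k o) == f.1.2 k))].

Definition moved (d : option bool) (h h' : nat) : bool :=
  match d with
  | None => h' == h
  | Some true => h' == h.+1
  | Some false => h'.+1 == h
  end.

Definition item_first (o : nat) : bool :=
  if item_info o is Some f then
    [&& item_time o == 0, f.1.1 == start M, [forall k, item_head k o == P]
      & well_founded_item f o]
  else false.

Definition item_last (o : nat) : bool :=
  if item_info o is Some f then (delta f.1.1 f.1.2 == set0) && accepting f.1.1 else false.

Definition item_succ (o o' : nat) : bool :=
  if item_info o is Some f then
    if item_info o' is Some f' then
      [&& item_time o' == (item_time o).+1, f.2 \in delta f.1.1 f.1.2, f'.1.1 == f.2.1,
          [forall k, moved (f.2.2 k).2 (item_head k o) (item_head k o')]
        & well_founded_item f' o']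
    else false
  else false.

(** Meant for [o] earlier than [o']. Taken over all earlier items, these conditions force the visit
    digit of [o'] to be the true last visit, and the scanned symbol to be the one written then. *)
Definition item_compat (o o' : nat) : bool :=
  if item_info o is Some f then
    if item_info o' is Some f' then
      [forall k, ((item_head k o == item_head k o') ==> (item_time o < item_visit k o')) &&
         ((item_visit k o' == (item_time o).+1) ==>
            (item_head k o == item_head k o') && ((f.2.2 k).1 == f'.1.2 k))]
    else false
  else false.

Definition item_conf (o o' : nat) : bool := ~~ item_compat o o'.

Definition item_path : Prop :=
  avoiding_path item_number item_first item_last item_succ item_conf.

Definition accepted : Prop :=
  exists n c, [/\ reaches n (init_config inj x) c, halted c & accepting (cstate c)].

(** Time is the most significant digit, so conflicts are tested on pairs in temporal order. *)
Lemma item_time_lt o o' : item_time o < item_time o' -> o < o'.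
Proof.
move=> lt; rewrite ltnNge; apply/negP => le; move: lt.
by rewrite ltnNge /item_time !leq_div2r.
Qed.

Lemma item_succ_lt o o' : item_succ o o' -> o < o'.
Proof.
rewrite /item_succ; do 2!case: item_info => // ?.
by case/and5P=> /eqP e _ _ _ _; apply: item_time_lt; rewrite e.
Qed.

Lemma initialE k h z : (z + P%:Z)%R = Posz h -> ctape (init_config inj x) k z = initial k h.
Proof.
rewrite /initial /= => e; case: (k == ord0) => //=; case: z e => j e.
  have -> : h = j + P by lia.
  by rewrite leq_addl addnK -onth_map odflt_onth.
by rewrite ifF //; lia.
Qed.

(** The run is rebuilt from the actions in the items. States and heads agree with the items by
    [item_succ], scanned symbols by the certified last visits. *)
Lemma accepted_of_item_path : item_path -> accepted.
Proof.
move=> [o [os [fo po lo _ free]]].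
pose g i := nth 0 (o :: os) i; pose n := size os.
pose f i := odflt info0 (item_info (g i)).
have sg i : i < n -> item_succ (g i) (g i.+1) by move=> lt; have /(pathP 0) := po; apply.
have H i : i <= n -> [/\ item_info (g i) = Some (f i), well_founded_item (f i) (g i)
    & item_time (g i) = i].
  elim: i => [|i IH] lt.
    move: fo; rewrite /item_first /f /g /=; case: item_info => // fi.
    by case/and4P=> /eqP.
  have [_ _ ti] := IH (ltnW lt).
  have := sg i lt; rewrite /item_succ; case: item_info => // fi.
  rewrite /f; case: (item_info (g i.+1)) => // fi'.
  by case/and5P=> /eqP; rewrite ti.
have {}sg i : i < n -> [/\ (f i).2 \in delta (f i).1.1 (f i).1.2, (f i.+1).1.1 = (f i).2.1 &
     forall k, moved ((f i).2.2 k).2 (item_head k (g i)) (item_head k (g i.+1))].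
  move=> lt; have := sg i lt; rewrite /item_succ.
  have [-> _ _] := H i (ltnW lt); have [-> _ _] := H i.+1 lt.
  by case/and5P=> _ -> /eqP-> /forallP.
have cg i j : i < j -> j <= n -> item_compat (g i) (g j).
  move=> lt le; have [_ _ ti] := H i (ltnW (leq_trans lt le)); have [_ _ tj] := H j le.
  rewrite -[item_compat _ _]negbK; apply: free; last by apply: item_time_lt; rewrite ti tj.
    by apply: mem_nth; rewrite /= ltnS; lia.
  by apply: mem_nth.
pose C := fix C i := if i is j.+1 then apply_action (C j) (f j).2 else init_config inj x.
have HC i : i < n -> C i.+1 = apply_action (C i) (f i).2 by [].
have hC i k : i <= n -> (chead (C i) k + P%:Z)%R = Posz (item_head k (g i)).
  elim: i => [|i IH] lt.
    move: fo; rewrite /item_first /=; case: item_info => // fi.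
    by case/and4P=> _ _ /forallP /(_ k) /eqP e _; rewrite /g /= e; lia.
  have [_ _ /(_ k)] := sg i lt; have := IH (ltnW lt).
  by rewrite /=; case: (((f i).2.2 k).2) => [[]|] /=; lia.
have qC i : i <= n -> cstate (C i) = (f i).1.1.
  case: i => [|i] lt; last by have [_ -> _] := sg i lt.
  move: fo; rewrite /item_first /f /g /=; case: item_info => // fi.
  by case/and4P=> _ /eqP.
have aC i : i <= n -> scanned (C i) = (f i).1.2.
  move=> le; apply/ffunP => k; rewrite ffunE (tape_content HC) //.
  have [ei /forallP /(_ k) /andP[vt v0] ti] := H i le.
  have ch j : j <= n -> (chead (C j) k == chead (C i) k) = (item_head k (g j) == item_head k (g i)).
    by move=> lej; have := hC j k lej; have := hC i k le; lia.
  have cp j : j < i -> ((item_head k (g j) == item_head k (g i)) ==> (j < item_visit k (g i))) &&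
     ((item_visit k (g i) == j.+1) ==>
        (item_head k (g j) == item_head k (g i)) && (((f j).2.2 k).1 == (f i).1.2 k)).
    move=> lt; have := cg j i lt le; rewrite /item_compat ei.
    have [-> _ tj] := H j (ltnW (leq_trans lt le)).
    by move/forallP/(_ k); rewrite tj.
  rewrite (@last_below_unique _ _ (item_visit k (g i))).
  - case ev: (item_visit k (g i)) => [|j].
      move: v0; rewrite ev eqxx /= => /eqP <-.
      by apply: initialE; rewrite hC.
    have /cp : j < i by rewrite -ti -ev.
    by rewrite ev eqxx /= => /andP[_ /andP[_ /eqP]].
  - by rewrite -[X in _ <= X]ti.
  - move=> j lt; have lej : j <= n by lia.
    by rewrite ch // => hj; have /andP[] := cp j lt; rewrite hj.
  - move=> j ev; have lt : j < i by rewrite -ti -ev.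
    have lej : j <= n by lia.
    by rewrite ch //; have /andP[_] := cp j lt; rewrite ev eqxx /= => /andP[].
exists n, (C n); split.
- apply: (reaches_seq (a := fun i => (f i).2)) => // i lt.
  by rewrite qC ?aC ?(ltnW lt) //; have [] := sg i lt.
- rewrite /halted qC // aC //; have [en _ _] := H n (leqnn n).
  by move: lo; rewrite (last_nth 0) /item_last en => /andP[/eqP].
rewrite qC //; have [en _ _] := H n (leqnn n).
by move: lo; rewrite (last_nth 0) /item_last en => /andP[].
Qed.

Definition item (t : nat) (f : info) (h v : 'I_K -> nat) : nat :=
  (digits radix (fun j => if odd j then v (inord j./2) else h (inord j./2)) K.*2
    + t * radix ^ K.*2) * #|info| + index f (enum info).

Lemma itemE t f h v : t <= P -> (forall k, h k < radix) -> (forall k, v k < radix) ->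
  let o := item t f h v in
  [/\ o < item_number, item_info o = Some f, item_time o = t,
      forall k, item_head k o = h k & forall k, item_visit k o = v k].
Proof.
move=> tP hr vr; rewrite /item; set G := fun j => _.
have Gr j : G j < radix by rewrite /G; case: ifP.
have fi : index f (enum info) < #|info| by rewrite cardE index_mem mem_enum.
have n0 : 0 < #|info| by apply: leq_ltn_trans fi.
have od : forall y, (y * #|info| + index f (enum info)) %/ #|info| = y.
  by move=> y; rewrite divnMDl // divn_small ?addn0.
have dG j : j < K.*2 ->
    item_digit j ((digits radix G K.*2 + t * radix ^ K.*2) * #|info| + index f (enum info)) = G j.
  by move=> lt; rewrite /item_digit od digitsE.
split.
- rewrite /item_number expnS mulnC.
  have := digits_lt K.*2 Gr; set y := digits _ _ _; set R := radix ^ _ => ltR.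
  have : (y + t * R).+1 <= radix * R by rewrite /radix; nia.
  by move: #|info| fi => I fi; nia.
- rewrite /item_info modnMDl modn_small //; apply/eqP.
  by rewrite onthE (nth_map f) ?nth_index ?mem_enum // index_mem mem_enum.
- by rewrite /item_time od digits_top.
- by move=> k; rewrite /item_head dG ?ltn_double // /G odd_double doubleK inord_val.
- move=> k; rewrite /item_visit dG ?ltn_Sdouble // /G /= odd_double /=.
  by rewrite uphalf_double inord_val.
Qed.

Lemma item_path_of_accepted :
  (forall n c, reaches n (init_config inj x) c -> n <= P) -> accepted -> item_path.
Proof.
move=> bound [n [c [r hc ac]]]; have nP := bound _ _ r.
have [C [a [C0 Cn Ha HC]]] := seq_of_reaches info0.2 r.
have hb : forall i k, i <= n -> exists2 h : nat, (chead (C i) k + P%:Z)%R = Posz h & h < radix.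
  move=> i k le; have [|h eh [h1 h2]] := @head_bound C a n _ HC i k le.
    by move=> k'; rewrite C0.
  (* The shift by [n] becomes a shift by [P]; the position is then at most [2P], below [radix]. *)
  by exists (h + (P - n)); rewrite /radix; lia.
pose h i k := absz (chead (C i) k + P%:Z)%R.
have hE i k : i <= n -> (chead (C i) k + P%:Z)%R = Posz (h i k) /\ h i k < radix.
  by move=> le; rewrite /h; have [m ->] := hb i k le.
pose v i k := last_below (fun j => chead (C j) k == chead (C i) k) i.
pose f i : info := (cstate (C i), scanned (C i), a i).
pose g i := item i (f i) (h i) (v i).
have gE i : i <= n -> [/\ g i < item_number, item_info (g i) = Some (f i), item_time (g i) = i,
      forall k, item_head k (g i) = h i k & forall k, item_visit k (g i) = v i k].
  move=> le; apply: itemE => [|k|k]; first exact: leq_trans nP.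
    by have [] := hE i k le.
  by apply: leq_ltn_trans (last_below_le _ _) _; rewrite /radix; lia.
have wf i : i <= n -> well_founded_item (f i) (g i).
  move=> le; have [_ _ ti hi vi] := gE i le; apply/forallP => k.
  rewrite hi vi ti last_below_le /=; apply/implyP => /eqP v0.
  have [eh _] := hE i k le.
  by rewrite ffunE (tape_content HC) // -/(v i k) v0 C0 (initialE _ eh).
exists (g 0), (mkseq (g \o succn) n).
have nthg i : i <= n -> nth 0 (g 0 :: mkseq (g \o succn) n) i = g i.
  by case: i => // i lt; rewrite /= nth_mkseq.
have memg o : o \in g 0 :: mkseq (g \o succn) n -> exists2 i, i <= n & o = g i.
  rewrite inE => /orP[/eqP->|/mapP[i]]; first by exists 0.
  by rewrite mem_iota => /andP[_ lt] ->; exists i.+1.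
split.
- have [_ e0 t0 h0 _] := gE 0 isT.
  rewrite /item_first e0 t0 /= wf // C0 eqxx !andbT /=.
  by apply/forallP => k; rewrite h0 /h C0 /=; lia.
- apply/(pathP 0) => i; rewrite size_mkseq => lt.
  rewrite nthg ?(ltnW lt) // nth_mkseq //=.
  have [_ ei ti hi _] := gE i (ltnW lt); have [_ ei' ti' hi' _] := gE i.+1 lt.
  rewrite /item_succ ei ei' ti ti' eqxx wf // /f /= Ha // HC // eqxx andbT /=.
  apply/forallP => k; rewrite hi hi'.
  have [e _] := hE i k (ltnW lt); have [e' _] := hE i.+1 k lt.
  move: e'; rewrite HC //=; case: (((a i).2 k).2) => [[]|] /=; lia.
- rewrite (last_nth 0) size_mkseq nthg //; have [_ en _ _ _] := gE n (leqnn n).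
  by rewrite /item_last en /= Cn hc eqxx.
- by move=> o /memg[i le ->]; have [] := gE i le.
move=> o o' /memg[i lei ->] /memg[j lej ->] lt.
have [_ ei ti hi _] := gE i lei; have [_ ej tj hj vj] := gE j lej.
(* Smaller items have no later time, and equal times would make the items equal. *)
have le : i <= j by rewrite -ti -tj /item_time !leq_div2r // ltnW.
have {}lt : i < j by rewrite ltn_neqAle le andbT; apply: contraTneq lt => ->; rewrite ltnn.
rewrite /item_conf negbK /item_compat ei ej; apply/forallP => k.
have [e _] := hE i k lei; have [e' _] := hE j k lej.
rewrite hi hj vj ti; apply/andP; split; apply/implyP => /eqP eh.
  by apply: last_below_ge => //; lia.
have /eqP ec := last_below_holds eh; rewrite /h ec eqxx /=.
by rewrite ffunE (tape_content HC) // -/(v j k) eh.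
Qed.
End Items.
End Runs.

(** * Instances and their encoding *)

Lemma rainbow_map (V W : eqType) (C D : eqType) r (c : V -> C) (d : W -> D)
  (phi : V -> W) (g : D -> C) p : injective g -> (forall v, c v = g (d (phi v))) ->
  rainbow r c p <-> rainbow r d (map phi p).
Proof.
move=> ginj cE.
have e i : uniq (map d (take r.+1 (drop i (map phi p)))) = uniq (map c (take r.+1 (drop i p))).
  rewrite -map_drop -map_take -map_comp -(map_inj_uniq ginj) -map_comp.
  by congr uniq; apply: eq_map => v /=.
by split=> H i; move: (H i); rewrite size_map e.
Qed.

Section Encoding.
Variables (r m : nat) (first last : nat -> bool) (succ conf : nat -> nat -> bool).
Hypotheses (r2 : 2 <= r) (m0 : 0 < m) (succ_lt : forall a b, succ a b -> a < b).

Definition order : nat := m * m * (r + 5).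

(** The level is the least significant digit, so 0 and 1 code the source and the target. *)
Definition decode (u : nat) : nat * nat * nat :=
  (u %/ (r + 5) %/ m, u %/ (r + 5) %% m, u %% (r + 5)).

Definition narc (u v : nat) : bool := varc r m first last succ conf (decode u) (decode v).

Lemma varc_irr u : varc r m first last succ conf u u = false.
Proof.
case: u => [[o o'] [|[|[|[|j]]]]] /=; rewrite ?andbF //.
have -> : (j.+4 == j.+1.+4) = false by rewrite (ltn_eqF (ltnSn _)).
by do 2 case: ifP => //=.
Qed.

Lemma order_gt1 : 1 < order.
Proof. by rewrite /order; nia. Qed.

Lemma narc_loopless :
  [forall v : 'I_order, (v, v) \notin [set p : 'I_order * 'I_order | narc p.1 p.2]].
Proof. by apply/forallP => v; rewrite inE /= /narc varc_irr. Qed.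

Definition vsource : 'I_order := Ordinal (ltnW order_gt1).
Definition vtarget : 'I_order := Ordinal order_gt1.

(* The colours and the length bound have the form 2^k - 1, whose binary notation is
   k ones. *)
Definition graph_instance : instance :=
  @Instance order [set p : 'I_order * 'I_order | narc p.1 p.2] narc_loopless
    [ffun v : 'I_order => 2 ^ label (decode v) - 1] vsource vtarget isT (2 ^ order - 1).

Lemma decodeE o o' j : o' < m -> j < r + 5 -> decode ((o * m + o') * (r + 5) + j) = (o, o', j).
Proof.
move=> lt1 lt2; rewrite /decode.
by rewrite divnMDl ?(leq_ltn_trans _ lt2) // modnMDl (divn_small lt2) (modn_small lt2) addn0
  divnMDl // modnMDl (divn_small lt1) (modn_small lt1) addn0.
Qed.

Lemma decode_inj : injective decode.
Proof.
move=> u v [e1 e2 e3].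
rewrite (divn_eq u (r + 5)) (divn_eq v (r + 5)) e3; congr (_ * _ + _).
by rewrite (divn_eq (u %/ (r + 5)) m) e1 e2 -divn_eq.
Qed.

Lemma decode0 : decode 0 = vs.
Proof. by apply: (@decodeE 0 0 0); lia. Qed.

Lemma decode1 : decode 1 = vt.
Proof. by apply: (@decodeE 0 0 1); lia. Qed.

Lemma yes_graph_instance :
  yes_instance r graph_instance <-> avoiding_path m first last succ conf.
Proof.
pose phi (v : 'I_order) := decode v.
have phi_inj : injective phi by move=> u v /decode_inj /val_inj.
have cE (v : 'I_order) : color graph_instance v = (fun n => 2 ^ n - 1) (label (phi v))
  by rewrite /= ffunE.
have ginj : injective (fun n => 2 ^ n - 1).
  move=> a b /= e; apply/eqP; rewrite -(eqn_exp2l _ _ (ltnSn 1)).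
  have := expn_gt0 2 a; have := expn_gt0 2 b; lia.
have pathE p : path (fun u v => (u, v) \in arcs graph_instance) (source graph_instance) p =
    path (varc r m first last succ conf) vs (map phi p).
  rewrite -decode0 (path_map (f := phi) (vsource)); apply: eq_path => u v.
  by rewrite /= inE.
have uniqE p : uniq (source graph_instance :: p) = uniq (vs :: map phi p).
  by rewrite -decode0 -(map_inj_uniq phi_inj).
split.
  case=> p [pp up lp rp _].
  apply: (avoiding_path_of_graph r2 m0 (p := map phi p)).
  - by rewrite -pathE.
  - by rewrite -uniqE.
  - rewrite -decode0 -decode1 (last_map phi p vsource) /phi.
    by move/(congr1 phi): lp.
  - rewrite -decode0 -[_ :: _]/(map phi (vsource :: p)).
    exact: (rainbow_map r _ ginj cE).1.
  move=> u /mapP[v _ ->] /=.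
  by rewrite !ltn_divLR ?addn_gt0 ?orbT //; apply: ltn_ord.
case=> o [os [fo po lo lem free]].
have [q [pq uq lq rq rg]] := graph_of_avoiding_path r2 m0 succ_lt fo po lo lem free.
(* The default [vsource] is never taken on [q], whose coordinates are bounded by [rg]. *)
pose enc (u : nat * nat * nat) : 'I_order := insubd vsource ((u.1.1 * m + u.1.2) * (r + 5) + u.2).
have encK u : u \in q -> phi (enc u) = u.
  move=> /rg; case: u => [[a a'] j] /= [lt1 lt2 lt3].
  rewrite /phi /enc insubdK; first exact: decodeE.
  rewrite unfold_in /order /=; have : (a * m + a').+1 <= m * m by nia.
  by move: (m * m) (_ + a') => Z y; nia.
have qE : map phi (map enc q) = q.
  by rewrite -map_comp -[RHS]map_id; apply/eq_in_map => u; apply: encK.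
exists (map enc q); split.
- by rewrite pathE qE.
- by rewrite uniqE qE.
- apply: phi_inj; rewrite -(last_map phi) qE /= [phi _]decode0 lq.
  by rewrite /phi decode1.
- by apply/(rainbow_map r _ ginj cE); rewrite /= qE [phi _]decode0.
(* A simple path has fewer than [order] arcs and [order <= 2^order - 1], so the length bound
   excludes nothing. *)
rewrite /= -/order -ltnS; apply: leq_trans (_ : order <= _); last first.
  by rewrite subn1 prednK ?expn_gt0 // ltnW // ltn_expl.
have : uniq (vsource :: map enc q) by rewrite uniqE qE.
by move/card_uniqP => /= <-; rewrite -[X in _ <= X]card_ord max_card.
Qed.

End Encoding.

Lemma bits_ones k : bits (2 ^ k - 1) = nseq k true.
Proof.
suff H n : k <= n -> bits_rec n (2 ^ k - 1) = nseq k true.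
  by apply: H; have := ltn_expl k (ltnSn 1); lia.
elim: k n => [|k IH] [|n] //= lt.
have k0 : 0 < 2 ^ k by rewrite expn_gt0.
rewrite expnS (_ : 2 * 2 ^ k - 1 = (2 ^ k - 1).*2.+1); last by lia.
by rewrite /= odd_double /= uphalf_double IH.
Qed.

Lemma flatten_const (T I : Type) (c : T) (s : seq I) :
  flatten [seq [:: c] | _ <- s] = nseq (size s) c.
Proof. by elim: s => //= _ s ->. Qed.

Lemma map_enum_ord (T : Type) (F : nat -> T) n :
  [seq F (nat_of_ord i) | i <- enum 'I_n] = [seq F i | i <- iota 0 n].
Proof. by rewrite -val_enum_ord -map_comp. Qed.

(** The source 0 has empty binary notation and the target 1 a single bit. All other fields are
    blocks of ones or rows of bits, so nested loops can print the word. *)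
Lemma encode_graph_instance r m first last succ conf (r2 : 2 <= r) (m0 : 0 < m) :
  encode (@graph_instance r m first last succ conf r2 m0) =
    [:: None; Some true; None] ++
    (flatten [seq [:: Some true] | _ <- iota 0 (order r m)] ++ [:: None]) ++
    flatten [seq flatten [seq [:: Some true] | _ <- iota 0 (label (decode r m v))] ++ [:: None]
            | v <- iota 0 (order r m)] ++
    flatten [seq flatten [seq [:: Some (narc r m first last succ conf u v)]
                         | v <- iota 0 (order r m)] ++ [:: None]
            | u <- iota 0 (order r m)].
Proof.
have mapE T F := esym (@map_enum_ord T F (order r m)).
rewrite !mapE /encode; move: (enum _) (size_enum_ord (order r m)) mapE => s sz mapE.
rewrite /encode_fields /= !bits_ones map_cat flatten_cat flatten_const sz.
rewrite map_nseq cats1; congr [:: _, _, _ & _ ++ flatten _ ++ flatten _].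
  rewrite -map_comp; apply: eq_map => v /=.
  by rewrite ffunE bits_ones flatten_const size_iota map_nseq cats1.
rewrite -map_comp; apply: eq_map => u /=.
rewrite cats1 -map_comp mapE; congr rcons.
by elim: s {sz mapE} => //= v s ->; rewrite inE.
Qed.

(** * Expressibility of the graph and polynomial-time printing of the instance *)

Section Expressible.
Variable A : finType.
Implicit Types (x : seq A) (env : seq nat).

Lemma eq_outputs (B : finType) (F G : seq A -> seq nat -> seq B) :
  (forall x env, F x env = G x env) -> outputs F -> outputs G.
Proof. by move=> e [o H]; exists o => x env; rewrite H e. Qed.

(** A conditional output is made of two loops, run [b] times and [~~ b] times. *)
Lemma outputs_bool (b : seq A -> seq nat -> bool) :
  expressible (fun x env => b x env : nat) ->
  outputs (fun x env => [:: Some (b x env)]).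
Proof.
move=> eb.
have := outputs_cat (outputs_for eb (outputs_sym A (Some true)))
  (outputs_for (expressible_neg eb) (outputs_sym A (Some false))).
by apply: eq_outputs => x env; case: (b x env).
Qed.

Lemma expressible_ifb (b F G : seq A -> seq nat -> bool) :
  expressible (fun x env => b x env : nat) -> expressible (fun x env => F x env : nat) ->
  expressible (fun x env => G x env : nat) ->
  expressible (fun x env => (if b x env then F x env else G x env) : bool).
Proof.
by move=> eb f g; apply: eq_expressible (expressible_if eb f g) => x env; case: (b x env).
Qed.

Lemma expressible_succ (F : seq A -> seq nat -> nat) : expressible F ->
  expressible (fun x env => (F x env).+1).
Proof. by move=> f; apply: (expressible_add (expressible_const _ 1) f). Qed.

End Expressible.

Ltac expr_tac := repeat first
  [ assumption
  | apply: expressible_const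
  | apply: expressible_expn
  | apply: expressible_and | apply: expressible_or | apply: expressible_neg
  | apply: expressible_imply | apply: expressible_leq | apply: expressible_eq
  | apply: expressible_forall => ? | apply: expressible_ifb
  | apply: expressible_succ | apply: expressible_add | apply: expressible_sub
  | apply: expressible_mul | apply: expressible_div | apply: expressible_mod
  | apply: expressible_if ].

Section ItemExpressible.
Variables (M : machine) (A : finType) (inj : A -> symbol M) (P : seq A -> nat).
Hypothesis eP : expressible (fun x _ => P x).
Implicit Types (F G : seq A -> seq nat -> nat).

Lemma expressible_radix : expressible (fun x _ => radix (P x)).
Proof.
apply: (@eq_expressible _ (fun x _ => (2 * P x).+2)).
  by move=> x _; rewrite /radix mul2n.
by do 2!apply: expressible_succ; expr_tac.
Qed.

Lemma expressible_item_digit F j : expressible F ->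
  expressible (fun x env => item_digit M (P x) j (F x env)).
Proof. by move=> f; have er := expressible_radix; rewrite /item_digit; expr_tac. Qed.

Lemma expressible_item_time F : expressible F ->
  expressible (fun x env => item_time M (P x) (F x env)).
Proof. by move=> f; have er := expressible_radix; rewrite /item_time; expr_tac. Qed.

(** The type [info M] is finite and fixed with the machine, so the case analysis is a lookup in a
    fixed list. *)
Lemma expressible_item_info F (G : info M -> seq A -> seq nat -> bool) : expressible F ->
  (forall i, expressible (fun x env => G i x env : nat)) ->
  expressible (fun x env => (if item_info M (F x env) is Some i then G i x env else false) : bool).
Proof.
move=> f g; rewrite /item_info.
have f' : expressible (fun x env => F x env %% #|info M|) by expr_tac.
apply: eq_expressible (expressible_lookup (enum (info M)) f' g) => x env.
by case: onth.
Qed.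

Lemma expressible_initial F k a : expressible F ->
  expressible (fun x env => initial inj (P x) x k (F x env) == a : nat).
Proof.
move=> f; apply: (@eq_expressible _ (fun x env =>
  (if (k == ord0) && (P x <= F x env) then odflt (blank M) (omap inj (onth x (F x env - P x))) == a
   else blank M == a) : bool)).
  by move=> x env; rewrite /initial; case: (_ && _).
apply: expressible_ifb; [by expr_tac | | by expr_tac].
by apply: (@expressible_input A (fun u => odflt (blank M) (omap inj u) == a)); expr_tac.
Qed.

Lemma expressible_well_founded_item f F : expressible F ->
  expressible (fun x env => well_founded_item inj (P x) x f (F x env) : nat).
Proof.
move=> eF; apply: expressible_forall => k.
have ev := expressible_item_digit k.*2.+1 eF; have eh := expressible_item_digit k.*2 eF.
have et := expressible_item_time eF.
by have ei := expressible_initial k (f.1.2 k) eh; expr_tac.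
Qed.

Lemma expressible_item_first F : expressible F ->
  expressible (fun x env => item_first inj (P x) x (F x env) : nat).
Proof.
move=> eF; rewrite /item_first; apply: (expressible_item_info eF) => i.
have et := expressible_item_time eF; have ew := expressible_well_founded_item i eF.
do 3?[apply: expressible_and]; try by expr_tac.
apply: expressible_forall => k; have eh := expressible_item_digit k.*2 eF.
by expr_tac.
Qed.

Lemma expressible_item_last F : expressible F ->
  expressible (fun x env => item_last M (F x env) : nat).
Proof. by move=> eF; rewrite /item_last; apply: (expressible_item_info eF) => i; expr_tac. Qed.

Lemma expressible_moved d F G : expressible F -> expressible G ->
  expressible (fun x env => moved d (F x env) (G x env) : nat).
Proof. by move=> f g; case: d => [[]|] /=; expr_tac. Qed.

Lemma expressible_item_succ F G : expressible F -> expressible G ->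
  expressible (fun x env => item_succ inj (P x) x (F x env) (G x env) : nat).
Proof.
move=> eF eG; rewrite /item_succ.
apply: (expressible_item_info eF) => i; apply: (expressible_item_info eG) => i'.
have et := expressible_item_time eF; have et' := expressible_item_time eG.
have ew := expressible_well_founded_item i' eG.
do 4?[apply: expressible_and]; try by expr_tac.
apply: expressible_forall => k.
exact: expressible_moved (expressible_item_digit _ eF) (expressible_item_digit _ eG).
Qed.

Lemma expressible_item_conf F G : expressible F -> expressible G ->
  expressible (fun x env => item_conf M (P x) (F x env) (G x env) : nat).
Proof.
move=> eF eG; apply: expressible_neg; rewrite /item_compat.
apply: (expressible_item_info eF) => i; apply: (expressible_item_info eG) => i'.
have et := expressible_item_time eF; apply: expressible_forall => k.
have ev := expressible_item_digit k.*2.+1 eG.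
have eh := expressible_item_digit k.*2 eF; have eh' := expressible_item_digit k.*2 eG.
by expr_tac.
Qed.

End ItemExpressible.

Section GraphExpressible.
Variables (A : finType) (r : nat) (m : seq A -> nat).
Variables (first last : seq A -> nat -> bool) (succ conf : seq A -> nat -> nat -> bool).
Implicit Types (F G : seq A -> seq nat -> nat).
Hypotheses (em : expressible (fun x _ => m x))
  (efirst : forall F, expressible F -> expressible (fun x env => first x (F x env) : nat))
  (elast : forall F, expressible F -> expressible (fun x env => last x (F x env) : nat))
  (esucc : forall F G, expressible F -> expressible G ->
     expressible (fun x env => succ x (F x env) (G x env) : nat))
  (econf : forall F G, expressible F -> expressible G ->
     expressible (fun x env => conf x (F x env) (G x env) : nat)).

Lemma expressible_order : expressible (fun x _ => order r (m x)).
Proof. by rewrite /order; expr_tac. Qed.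

Lemma expressible_can F G F' G' : expressible F -> expressible G -> expressible F' ->
  expressible G' ->
  expressible (fun x env => (F' x env, G' x env) == can (conf x) (F x env) (G x env) : nat).
Proof.
move=> f g f' g'.
have c := econf g f.
apply: (@eq_expressible _ (fun x env =>
  (if (G x env < F x env) && conf x (G x env) (F x env)
   then (F' x env == G x env) && (G' x env == F x env)
   else (F' x env == F x env) && (G' x env == G x env)) : bool)).
  by move=> x env; rewrite /can; case: ifP.
by expr_tac.
Qed.

Lemma expressible_label F : expressible F ->
  expressible (fun x env => label (decode r (m x) (F x env))).
Proof. by move=> f; rewrite /label /decode; expr_tac. Qed.

Lemma expressible_narc F G : expressible F -> expressible G ->
  expressible (fun x env =>
    narc r (m x) (first x) (last x) (succ x) (conf x) (F x env) (G x env) : nat).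
Proof.
move=> f g; rewrite /narc /varc /decode.
have quo H : expressible H -> expressible (fun x env => H x env %/ (r + 5) %/ m x)
  by move=> h; expr_tac.
have rem H : expressible H -> expressible (fun x env => H x env %/ (r + 5) %% m x)
  by move=> h; expr_tac.
have fq := quo _ f; have fr := rem _ f; have gq := quo _ g; have gr := rem _ g.
have e1 := efirst gq; have e2 := esucc fq gq; have e3 := elast fq.
have e4 := expressible_can fq fr gq gr; have e5 := expressible_can gq gr fq fr.
by expr_tac.
Qed.

Lemma polytime_encode (r2 : 2 <= r) (m0 : forall x, 0 < m x) :
  polytime (fun x =>
    encode (@graph_instance r (m x) (first x) (last x) (succ x) (conf x) r2 (m0 x))).
Proof.
pose hash := outputs_sym A (None : option bool).
have one := outputs_sym A (Some true).
have row (F : seq A -> seq nat -> seq (option bool)) : outputs F -> outputs (fun x env =>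
    flatten [seq F x (i :: env) | i <- iota 0 (order r (m x))]).
  by apply: outputs_for expressible_order.
have var i := expressible_var A i.
apply: (@outputs_polytime _ _ (fun x _ =>
  encode (graph_instance (first x) (last x) (succ x) (conf x) r2 (m0 x)))).
(* In the matrix, variable 1 is the row and variable 0 the column. *)
have H := outputs_cat (outputs_cat hash (outputs_cat one hash))
  (outputs_cat (outputs_cat (row _ one) hash)
  (outputs_cat (row _ (outputs_cat (outputs_for (expressible_label (var 0)) one) hash))
  (row _ (outputs_cat (row _ (outputs_bool (expressible_narc (var 1) (var 0)))) hash)))).
by apply: eq_outputs H => x env; rewrite encode_graph_instance.
Qed.

End GraphExpressible.

(** * Assembly of the reduction *)

Theorem theorem18 (r : nat) (hr : 2 <= r) : NP_hard (locally_rainbow_path r).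
Proof.
move=> A L [M [inj [T [_ [c [d Tb]] bound HL]]]].
(* The time bound [T] is an arbitrary function; the polynomial above it is expressible. *)
pose P (x : seq A) := c * size x ^ d + c.
pose m x := item_number M (P x).
have m0 x : 0 < m x.
  rewrite /m /item_number muln_gt0 expn_gt0 /= andbT.
  by apply/card_gt0P; exists (info0 M).
have eP : expressible (fun x (_ : seq nat) => P x).
  by have es := expressible_size A; rewrite /P; expr_tac.
exists (fun x => encode (graph_instance (item_first inj (P x) x) (@item_last M)
  (item_succ inj (P x) x) (item_conf M (P x)) hr (m0 x))); split.
  apply: (@polytime_encode A r m (fun x => item_first inj (P x) x) (fun _ => @item_last M)
    (fun x => item_succ inj (P x) x) (fun x => item_conf M (P x))).
  - by have er := expressible_radix eP; rewrite /m /item_number; expr_tac.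
  - by move=> F; apply: expressible_item_first.
  - by move=> F; apply: expressible_item_last.
  - by move=> F G; apply: expressible_item_succ.
  - by move=> F G; apply: expressible_item_conf.
move=> x.
have yes := yes_graph_instance (item_first inj (P x) x) (@item_last M) (item_conf M (P x))
  hr (m0 x) (@item_succ_lt M A inj (P x) x).
(* Injectivity of [encode] identifies the instance behind the word. *)
rewrite HL; split=> [acc|[I [/encode_inj <-]]].
  eexists; split; first by [].
  apply/yes/item_path_of_accepted => // n c' /bound le.
  exact: leq_trans le (Tb _).
by move/yes/accepted_of_item_path.
Qed.
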